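(* Let $N$ be a feed-forward network and let $f\in\mathcal{V}_0(N)$ be generic. If $(\delta,(p_c)_c,(s_c)_c)\in\Omega(N,f)$, then there exists a unique $b\in\mathcal{B}(N,f)$ such that $\Theta(b)=(\delta,(p_c)_c,(s_c)_c)$.
   Context: A network $N$ with $k$ edge types is a finite set of cells $C$ together with functions $\sigma_1,\dots,\sigma_k:C\to C$ ($\sigma_i(c)$ is the source of the unique edge of type $i$ targeting $c$); $|N|=|C|$. A feed-forward network is a network whose cells can be partitioned into layers $C_0,\dots,C_m$ such that $\sigma_i(c)=c$ for $c\in C_0$ and all $i$; $\sigma_i(C_j)\subseteq C_{j-1}$ for $1\le j\le m$ and all $i$; and for $0\le j\le m-1$ every $c\in C_j$ equals $\sigma_i(c')$ for some $c'\in C_{j+1}$ and some $i$. Feed-forward networks are assumed connected (as undirected graphs). $\mathcal{V}(N)$ is the set of smooth $f:\mathbb{R}\times\mathbb{R}^k\times\mathbb{R}\to\mathbb{R}$, with variables $(x_0,x_1,\dots,x_k,\lambda)$, such that $f(0,0,\dots,0,\lambda)=0$ for all $\lambda$. Write $f_i$ for $\partial f/\partial x_i$, $f_{ij}$ for $\partial^2 f/\partial x_i\partial x_j$ and $f_{i\lambda}$ for $\partial^2 f/\partial x_i\partial\lambda$, all at the origin. $\mathcal{V}_0(N)=\{f\in\mathcal{V}(N): f_0=0\}$. The family of vector fields $f^N$ on $\mathbb{R}^{|N|}$ is $(f^N(x,\lambda))_c=f(x_c,x_{\sigma_1(c)},\dots,x_{\sigma_k(c)},\lambda)$. ''Generic''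 means: there is an open dense subset $O$ of the space of possible values of the first and second order partial derivatives at the origin of elements of the class, such that the statement holds for every $f$ in the class whose derivatives lie in $O$. A domain is an interval $]-\lambda_0,0]$, $]-\lambda_0,\lambda_0[$ or $[0,\lambda_0[$ with $\lambda_0>0$. An equilibrium branch of $f$ on $N$ is a germ of a function $b:D\to\mathbb{R}^{|N|}$ on a domain $D$ with $b(0)=0$ and $f^N(b(\lambda),\lambda)=0$ for all $\lambda\in D$; $b$ is smooth if $D=]-\lambda_0,\lambda_0[$, and continuous on $D$ and smooth on $D\setminus\{0\}$ if $D$ is one-sided. Germs: $b_1:D_1\to\mathbb{R}^{|N|}$ and $b_2:D_2\to\mathbb{R}^{|N|}$ are related if there is an open neighborhood $U$ of $0$ with $U\cap D_1\cap D_2\ne\{0\}$ and $b_1=b_2$ on $U\cap D_1\cap D_2$; germ equivalence is the transitive closure of this relation, and equivalent functions are identified. $\mathcal{B}(N,f)$ is the set of equilibrium branches of $f$ on $N$. Square-root-order and slope: for $b$ defined on $D=[0,\lambda_0[$ or $D=]-\lambda_0,0]$ and a cell $c$ with $b_c\ne0$, $b_c$ has square-root-order $p_c$ and slope $s_c$ if $p_c$ is the smallest non-negative integer such that there is a smooth $b_c^*:[0,\lambda_0^{2^{-p_c}}[\to\mathbb{R}$ with $b_c(\lambda)=b_c^*(|\lambda|^{2^{-p_c}})$ and $s_c=\lim_{|\lambda|\searrow0,\ \lambda\in D} b_c^*(|\lambda|)/\lambda\neq 0$. If $b_c=0$, it has square-root-order $-1$ and slope $0$. For branches defined in a neighborhood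 of $0$ the order and slope are those of the restrictions to $\lambda\ge 0$ and to $\lambda\le0$ (which coincide). The map $\Theta:\mathcal{B}(N,f)\to\{-1,0,1\}\times\mathbb{Z}^{|N|}\times\mathbb{R}^{|N|}$ is $\Theta(b)=(\delta,(p_c)_c,(s_c)_c)$, where $\delta=0$ if some function in the germ equivalence class of $b$ is defined in an open neighborhood of $0$, $\delta=1$ (resp. $-1$) if $b$ is defined only for positive (resp. negative) values of $\lambda$, and $b_c$ has square-root-order $p_c$ and slope $s_c$ for each cell $c$. $\Omega(N,f)$ is the set of $(\delta,(p_c)_c,(s_c)_c)\in\{-1,0,1\}\times\mathbb{Z}^{|N|}\times\mathbb{R}^{|N|}$ such that: (1) if $\delta=0$ then $p_c\le 0$ for all cells $c$; and for every cell $c$: (2) if $p_c=-1$ then $p_{\sigma_i(c)}=-1$ for all $i$; (3) if $p_c>-1$ then $p_{\sigma_i(c)}\le p_c-1$ for all $i$, and $p_{\sigma_{i'}(c)}=p_c-1$ for some $i'$; (4) $p_c=-1$ if and only if $s_c=0$; (5) if $p_c=0$ then $s_c=-2f_{0\lambda}/f_{00}$; (6) if $p_c>0$ then $s_c=\pm\sqrt{-\frac{2\delta}{f_{00}}\sum_{i\in A_c}f_i s_{\sigma_i(c)}}$ (either sign), where $A_c=\{i: p_{\sigma_i(c)}=p_c-1\}$.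
   Formalization: Adds that p_c ≥ -1 for all cells and that δ ≠ 0 forces some p_c > 0; Ω as written also contains tuples such as p ≡ -2, s ≡ 1, δ = 0 or δ = 1, p ≡ -1, s ≡ 0, which no branch realizes, and for generic f only unrealizable tuples are removed. *)

(* Defs.v *)
From HB Require Import structures.
From mathcomp Require Import all_boot all_order all_algebra.
From mathcomp Require Import all_classical all_reals all_analysis.
From Stdlib Require Export Relation_Operators.

Set Implicit Arguments.
Unset Strict Implicit.
Unset Printing Implicit Defensive.

Import Order.TTheory GRing.Theory Num.Theory.
Import numFieldNormedType.Exports.

Local Open Scope classical_set_scope.
Local Open Scope ring_scope.

(* All iterated directional derivatives of length at most n exist and are
   continuous at every point of U; for U open and V finite-dimensional this is
   the usual class C^n on U. *)
Fixpoint C_order (R : realType) (V : normedModType R) (n : nat) (U : set V)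
    (f : V -> R) : Prop :=
  (forall x, U x -> {for x, continuous f}) /\
  match n with
  | 0 => True
  | n'.+1 => forall v : V,
      (forall x, U x -> derivable f x v) /\ C_order n' U ('D_v f)
  end.

(* Smoothness on an arbitrary set A: local existence of smooth extensions to
   open sets (only the values of f on A matter). *)
Definition smooth_on (R : realType) (V : normedModType R) (A : set V)
    (f : V -> R) : Prop :=
  forall x, A x -> exists U : set V, exists g : V -> R,
    [/\ open U, U x, forall n, C_order n U g &
        forall y, U y -> A y -> f y = g y].

Record network (k : nat) := Network {
  cell : finType;
  src : 'I_k -> cell -> cell   (* source of the edge of type i targeting c *)
}.

Definition feed_forward_layers (k : nat) (N : network k) : Prop :=
  exists (m : nat) (layer : cell N -> 'I_m.+1),
    [/\ forall j : 'I_m.+1, exists c, layer c = j,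
        forall c, layer c = 0%N :> nat -> forall i, src i c = c,
        forall c, (0 < layer c)%N ->
          forall i, (layer (src i c)).+1 = layer c :> nat &
        forall c, (layer c < m)%N ->
          exists c' i, layer c' = (layer c).+1 :> nat /\ src i c' = c].

Definition adjacent (k : nat) (N : network k) : rel (cell N) :=
  fun c d => [exists i, (src i c == d) || (src i d == c)].

Definition connected_network (k : nat) (N : network k) : Prop :=
  forall c d : cell N, connect (@adjacent k N) c d.

Definition feed_forward (k : nat) (N : network k) : Prop :=
  feed_forward_layers N /\ connected_network N.

(* The variables (x_0, x_1, ..., x_k, lambda) are the 1 + k + 1 coordinates of
   a row vector. *)
Definition vars (R : realType) (k : nat) (x0 : R) (x : 'I_k -> R) (lam : R) :
    'rV[R]_(1 + k + 1) :=
  row_mx (row_mx (x0%:M : 'rV[R]_1) (\row_i x i)) (lam%:M : 'rV[R]_1).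

Definition ix0 (k : nat) : 'I_(1 + k + 1) := lshift 1 (lshift k ord0).
Definition ix (k : nat) (i : 'I_k) : 'I_(1 + k + 1) := lshift 1 (rshift 1 i).
Definition ilam (k : nat) : 'I_(1 + k + 1) := rshift (1 + k) ord0.

Definition partial (R : realType) (n : nat) (i : 'I_n) (f : 'rV[R]_n -> R) :
    'rV[R]_n -> R :=
  'D_(delta_mx 0 i) f.

Definition d1 (R : realType) (n : nat) (f : 'rV[R]_n -> R) (i : 'I_n) : R :=
  partial i f 0.

Definition d2 (R : realType) (n : nat) (f : 'rV[R]_n -> R) (i j : 'I_n) : R :=
  partial i (partial j f) 0.

(* Depends on the network only through its number k of edge types. *)
Definition calV (R : realType) (k : nat) : set ('rV[R]_(1 + k + 1) -> R) :=
  [set f | smooth_on setT f /\ forall lam, f (vars 0 (fun=> 0) lam) = 0].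

Definition calV0 (R : realType) (k : nat) : set ('rV[R]_(1 + k + 1) -> R) :=
  [set f | calV f /\ d1 f (ix0 k) = 0].

Definition jet2 (R : realType) (n : nat) (f : 'rV[R]_n -> R) :
    ('rV[R]_n * 'M[R]_n)%type :=
  (\row_i d1 f i, \matrix_(i, j) d2 f i j).

(* The property P holds for generic f in the class A: O is relatively open and
   dense in the set J of possible values of the derivatives of order 1 and 2 at
   the origin of elements of A. *)
Definition generically (R : realType) (n : nat) (A : set ('rV[R]_n -> R))
    (P : ('rV[R]_n -> R) -> Prop) : Prop :=
  let J : set ('rV[R]_n * 'M[R]_n) := @jet2 R n @` A in
  exists O : set ('rV[R]_n * 'M[R]_n),
    [/\ exists2 W, open W & O = W `&` J,
        J `<=` closure O &
        forall f, A f -> O (jet2 f) -> P f].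

Definition network_field (R : realType) (k : nat) (N : network k)
    (f : 'rV[R]_(1 + k + 1) -> R) (x : cell N -> R) (lam : R) : cell N -> R :=
  fun c => f (vars (x c) (fun i => x (src i c)) lam).

Variant domain_kind := left_sided | two_sided | right_sided.

Definition domain (R : realType) (K : domain_kind) (l : R) : set R :=
  match K with
  | left_sided => [set` `]- l, 0]]
  | two_sided => [set` `]- l, l[]
  | right_sided => [set` `[0, l[]
  end.

(* A representative of an equilibrium branch; the values of bfun outside the
   domain are irrelevant, and germs are taken into account by germ_equiv. *)
Record branch (R : realType) (k : nat) (N : network k)
    (f : 'rV[R]_(1 + k + 1) -> R) := Branch {
  kind : domain_kind;
  radius : R;
  bfun :> R -> cell N -> R;
  radius_gt0 : 0 < radius;
  branch_at0 : forall c, bfun 0 c = 0;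
  branch_eq : forall lam, domain kind radius lam ->
    forall c, network_field f (bfun lam) lam c = 0;
  branch_reg : forall c,
    match kind with
    | two_sided => smooth_on (domain kind radius) (bfun^~ c)
    | _ => {within domain kind radius, continuous (bfun^~ c)} /\
           smooth_on (domain kind radius `\ 0) (bfun^~ c)
    end
}.

Section Branches.
Variables (R : realType) (k : nat) (N : network k).
Variable f : 'rV[R]_(1 + k + 1) -> R.
Implicit Types b : branch N f.

Definition bdomain b : set R := domain (kind b) (radius b).

Definition germ_related b1 b2 : Prop :=
  exists U : set R,
    [/\ open U, U 0, U `&` bdomain b1 `&` bdomain b2 <> [set 0] &
        forall lam, (U `&` bdomain b1 `&` bdomain b2) lam ->
          forall c, b1 lam c = b2 lam c].

(* The elements of B(N, f) are the classes of germ_equiv.  The intermediate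
   functions of the transitive closure are equilibrium branches themselves:
   arbitrary ones would identify everything. *)
Definition germ_equiv : branch N f -> branch N f -> Prop :=
  clos_trans _ germ_related.

End Branches.

(* |lam| to the power 2^(-p) *)
Definition root2 (R : realType) (p : nat) (x : R) : R := `|x| `^ (2%:R ^- p).

(* u, defined on the one-sided domain D of radius l, is v(|lam|^(2^-p)) for a
   smooth v on [0, l^(2^-p)[ whose slope lim v(|lam|) / lam is s <> 0. *)
Definition sqrt_expansion (R : realType) (D : set R) (l : R) (u : R -> R)
    (p : nat) (s : R) : Prop :=
  exists v : R -> R,
    [/\ smooth_on [set` `[0, root2 p l[] v,
        forall lam, D lam -> u lam = v (root2 p lam),
        v `|lam| / lam @[lam --> within (D `\ 0) (nbhs (0 : R))] --> s &
        s != 0].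

Definition order_slope (R : realType) (D : set R) (l : R) (u : R -> R)
    (p : int) (s : R) : Prop :=
  (* u vanishes as a germ *)
  [/\ \forall lam \near within D (nbhs (0 : R)), u lam = 0,
      p = -1 & s = 0]
  \/
  exists2 n : nat, p = n%:Z &
    sqrt_expansion D l u n s /\
    forall n' s', (n' < n)%N -> ~ sqrt_expansion D l u n' s'.

Section Theta.
Variables (R : realType) (k : nat) (N : network k).
Variable f : 'rV[R]_(1 + k + 1) -> R.
Implicit Type b : branch N f.

Definition cell_order_slope b (c : cell N) (p : int) (s : R) : Prop :=
  let on K := order_slope (domain K (radius b)) (radius b) (b^~ c) p s in
  match kind b with
  | two_sided => on left_sided /\ on right_sided
  | K => on K
  end.

Definition extends_around0 b : Prop :=
  exists2 b' : branch N f, germ_equiv b b' & kind b' = two_sided.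

Definition has_delta b (delta : int) : Prop :=
  [\/ delta = 0 /\ extends_around0 b,
      delta = 1 /\ (~ extends_around0 b /\ kind b = right_sided) |
      delta = -1 /\ (~ extends_around0 b /\ kind b = left_sided)].

(* Graph of the map Theta: Theta(b) = (delta, p, s). *)
Definition Theta b (delta : int) (p : cell N -> int) (s : cell N -> R) : Prop :=
  has_delta b delta /\ forall c, cell_order_slope b c (p c) (s c).

End Theta.

Definition radicand (R : realType) (k : nat) (N : network k)
    (f : 'rV[R]_(1 + k + 1) -> R) (delta : int) (p : cell N -> int)
    (s : cell N -> R) (c : cell N) : R :=
  - (2%:R * delta%:~R / d2 f (ix0 k) (ix0 k)) *
    \sum_(i < k | p (src i c) == p c - 1) d1 f (ix i) * s (src i c).

(* These conditions alone do not exclude p c < -1, nor delta <> 0 with every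
   p c <= 0 (e.g. p = -1, s = 0, whose only branch is 0, for which delta = 0);
   Theta never takes such values for generic f, so a statement about the
   realizability of the elements of Omega must rule them out separately.
   The sign in the last condition is free at each cell, and the square root is
   required to be that of a non-negative real. *)
Definition Omega (R : realType) (k : nat) (N : network k)
    (f : 'rV[R]_(1 + k + 1) -> R) (delta : int) (p : cell N -> int)
    (s : cell N -> R) : Prop :=
  [/\ delta \in [:: -1; 0; 1],
      delta = 0 -> forall c, p c <= 0 &
      forall c,
        [/\ p c = -1 -> forall i, p (src i c) = -1,
            p c > -1 -> (forall i, p (src i c) <= p c - 1) /\
                        (exists i, p (src i c) = p c - 1),
            p c = -1 <-> s c = 0,
            p c = 0 ->
              s c = - (2%:R * d2 f (ix0 k) (ilam k)) / d2 f (ix0 k) (ix0 k) &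
            p c > 0 ->
              0 <= radicand f delta p s c /\
              (s c = Num.sqrt (radicand f delta p s c) \/
               s c = - Num.sqrt (radicand f delta p s c))]].

(* Main.v *)
(* A cell c of order n >= 0 only sees cells of smaller order, so the branch is
   built by induction on the order.  With mu = |lam|^(2^-n), the sources of c
   enter its equation as functions of mu^2, and the unknown is sought in the
   form mu * z.  Since f has no linear term in x_0 and lam, Hadamard's lemma
   shows that f(mu * z, ...) / mu^2 extends to a smooth function F(z, mu), and
   F(z, 0) is a quadratic polynomial in z of which (up to the sign of lam) the
   prescribed slope s_c is a simple root: for n = 0 it is the nonzero root of
   z * (f_00 z / 2 + f_0lam), for n > 0 one of the two square roots.  The
   implicit function theorem then gives a smooth z(mu), and its local
   uniqueness forces any branch with the same data to coincide with this one,
   because b_c / mu tends to that root.  For delta <> 0 a cell of positive order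
   behaves like |lam|^(2^-n), hence no smooth two-sided continuation exists. *)

Require Import Defs.
From HB Require Import structures.
From mathcomp Require Import all_boot all_order all_algebra.
From mathcomp Require Import all_classical all_reals all_analysis.
From mathcomp Require Import ring lra zify.

Set Implicit Arguments.
Unset Strict Implicit.
Unset Printing Implicit Defensive.

Import Order.TTheory GRing.Theory Num.Theory.
Import numFieldNormedType.Exports.

Local Open Scope classical_set_scope.
Local Open Scope ring_scope.

(** * Functions of class C^n *)

(** The genericity used is f_00 <> 0 and f_0lam <> 0. It serves to make the root of the limiting
    quadratic simple: the derivative there is, up to sign, f_0lam for a cell of order 0 and f_00 s_c
    for a cell of positive order, where s_c <> 0 by [Omega]. As f vanishes on the lam axis, f_lam
    and f_lamlam are zero; the first allows the division by mu^2 at order 0, the second removes the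
    constant term there. The implicit function theorem needs mu in a full neighbourhood of 0. The
    unknowns are therefore functions of mu of either sign, and cells are coupled only through powers
    mu^(2^j), never through roots; |lam|^(2^-n) is substituted at the end. For delta = 0 all orders
    are at most 0 and mu is lam itself, so that one function serves both sides. Smoothness is given
    by iterated directional derivatives only. Linearity in the direction and the chain rule come
    from the mean value theorem, symmetry of second derivatives from Hadamard's lemma. *)

Section COrder.
Variables (R : realType) (V : normedModType R).
Implicit Types (U : set V) (f g : V -> R) (n : nat).

Lemma C_order_continuous n U f x : U x -> C_order n U f -> {for x, continuous f}.
Proof. by move=> Ux; case: n => [|n] [+ _]; apply. Qed.

Lemma C_order_derivable n U f x v : U x -> C_order n.+1 U f -> derivable f x v.
Proof. by move=> Ux [_ /(_ v)[+ _]]; apply. Qed.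

Lemma C_order_derive n U f v : C_order n.+1 U f -> C_order n U ('D_v f).
Proof. by move=> [_ /(_ v)[]]. Qed.

Lemma C_order_eq n U f g : open U -> (forall x, U x -> f x = g x) ->
  C_order n U f -> C_order n U g.
Proof.
move=> oU; elim: n f g => [|n IH] f g fg.
  move=> [cf _]; split => // x Ux.
  have nfg : \near x, f x = g x.
    by apply: filterS fg _; exact: open_nbhs_nbhs.
  rewrite /prop_for /continuous_at -(fg x Ux).
  by apply: cvg_trans (cf x Ux); apply: near_eq_cvg.
move=> [cf df].
have nfg x : U x -> \near x, f x = g x.
  by move=> Ux; apply: filterS fg _; exact: open_nbhs_nbhs.
split.
  move=> x Ux.
  rewrite /prop_for /continuous_at -(fg x Ux).
  by apply: cvg_trans (cf x Ux); apply: near_eq_cvg; exact: nfg.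
move=> v; have [dfv Cfv] := df v; split.
  by move=> x Ux; apply: near_eq_derivable (nfg x Ux) (dfv x Ux).
apply: IH Cfv => x Ux.
exact/near_eq_derive/nfg.
Qed.

Lemma C_orderW n U f : C_order n.+1 U f -> C_order n U f.
Proof.
elim: n f => [|n IH] f [cf df]; split => // v.
by have [d C] := df v; split => //; apply: IH.
Qed.

(** The derivatives are usually known by a formula valid on U only. Allowing any family [df] that
    agrees with them there turns each closure property below into an induction on n. *)
Lemma C_orderI n U f (df : V -> V -> R) : open U ->
  (forall x, U x -> {for x, continuous f}) ->
  (forall x v, U x -> is_derive x v f (df v x)) ->
  (forall v, C_order n U (df v)) -> C_order n.+1 U f.
Proof.
move=> oU cf fdf Cdf; split => // v; split.
  by move=> x Ux; have [] := fdf x v Ux.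
apply: C_order_eq (Cdf v) => // x Ux.
by have [] := fdf x v Ux.
Qed.

Lemma C_order_sub n U U' f : U' `<=` U -> C_order n U f -> C_order n U' f.
Proof.
move=> sU; elim: n f => [|n IH] f [cf df]; split => //; try by move=> x /sU/cf.
by move=> v; have [d C] := df v; split; [move=> x /sU/d|exact: IH].
Qed.

Lemma C_order_local n U f :
  (forall x, U x -> exists2 U', U' x & C_order n U' f) -> C_order n U f.
Proof.
elim: n f => [|n IH] f H; split => //.
- by move=> x /H[U' U'x [cf _]]; apply: cf.
- by move=> x /H[U' U'x [cf _]]; apply: cf.
move=> v; split.
  by move=> x /H[U' U'x [_ /(_ v)[+ _]]]; apply.
by apply: IH => x /H[U' U'x [_ /(_ v)[_ C]]]; exists U'.
Qed.

Lemma smooth_on_C_order (A : set V) f : open A ->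
  smooth_on A f <-> forall n, C_order n A f.
Proof.
move=> oA; split=> [sf n|Cf x Ax]; last by exists A, f; split.
apply: C_order_local => x Ax; have [U [g [oU Ux Cg fg]]] := sf x Ax.
exists (U `&` A); first by [].
apply: (@C_order_eq _ _ g); first exact: openI.
  by move=> y [Uy Ay]; rewrite fg.
by apply: C_order_sub (Cg n) => y [].
Qed.

Lemma C_order_cst n U (a : R) : C_order n U (cst a).
Proof.
elim: n a => [|n IH] a; split => //; try by move=> x _; exact: cst_continuous.
move=> v; split; first by move=> x _; exact: derivable_cst.
have -> : 'D_v (cst a : V -> R) = cst 0 by apply/funext => x; rewrite derive_cst.
exact: IH.
Qed.

Lemma C_orderD n U f g : open U ->
  C_order n U f -> C_order n U g -> C_order n U (fun x => f x + g x).
Proof.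
move=> oU; elim: n f g => [|n IH] f g Cf Cg.
  split => // x Ux; apply: cvgD; [exact: (C_order_continuous Ux Cf)|exact: (C_order_continuous Ux Cg)].
apply: (@C_orderI _ _ _ (fun v x => 'D_v f x + 'D_v g x)) => //.
- by move=> x Ux; apply: cvgD; [exact: (C_order_continuous Ux Cf)|exact: (C_order_continuous Ux Cg)].
- move=> x v Ux; have df := derivableP (C_order_derivable Ux Cf).
  have dg := derivableP (C_order_derivable Ux Cg).
  exact: is_deriveD.
- by move=> v; apply: IH; exact: C_order_derive.
Qed.

Lemma C_orderM n U f g : open U ->
  C_order n U f -> C_order n U g -> C_order n U (fun x => f x * g x).
Proof.
move=> oU; elim: n f g => [|n IH] f g Cf Cg.
  split => // x Ux; apply: cvgM; [exact: (C_order_continuous Ux Cf)|exact: (C_order_continuous Ux Cg)].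
apply: (@C_orderI _ _ _ (fun v x => f x * 'D_v g x + g x * 'D_v f x)) => //.
- by move=> x Ux; apply: cvgM; [exact: (C_order_continuous Ux Cf)|exact: (C_order_continuous Ux Cg)].
- move=> x v Ux; have df := derivableP (C_order_derivable Ux Cf).
  have dg := derivableP (C_order_derivable Ux Cg).
  exact: is_deriveM.
- by move=> v; apply: C_orderD => //; apply: IH;
    [exact: C_orderW|exact: C_order_derive..|exact: C_orderW|exact: C_order_derive].
Qed.

Lemma C_order_sum n U (I : Type) (r : seq I) (P : pred I) (F : I -> V -> R) : open U ->
  (forall i, P i -> C_order n U (F i)) ->
  C_order n U (fun x => \sum_(i <- r | P i) F i x).
Proof.
move=> oU CF; elim: r => [|i r IH].
  rewrite (_ : (fun x => _) = cst 0); first exact: C_order_cst.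
  by apply/funext => x; rewrite big_nil.
have [Pi|nPi] := boolP (P i); last first.
  rewrite (_ : (fun x => _) = (fun x => \sum_(j <- r | P j) F j x)) //.
  by apply/funext => x; rewrite big_cons (negbTE nPi).
rewrite (_ : (fun x => _) = (fun x => F i x + \sum_(j <- r | P j) F j x)); last first.
  by apply/funext => x; rewrite big_cons Pi.
by apply: C_orderD => //; exact: CF.
Qed.

Lemma C_orderX n U f m : open U -> C_order n U f -> C_order n U (fun x => f x ^+ m).
Proof.
move=> oU Cf; elim: m => [|m IH]; first exact: C_order_cst.
rewrite (_ : (fun x => _) = (fun x => f x * f x ^+ m)); last first.
  by apply/funext => x; rewrite exprS.
exact: C_orderM.
Qed.

End COrder.

Section Linear.
Variables (R : realType) (V W : normedModType R).

(** The difference quotient of [f \o L] in direction v is literally that of f in direction [L v], so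
    no chain rule is involved. *)
Lemma C_order_comp_linear n (U : set V) (f : V -> R) (L : {linear W -> V}) :
  continuous L -> C_order n U f -> C_order n (L @^-1` U) (f \o L).
Proof.
move=> cL; elim: n f => [|n IH] f Cf; split => //.
- move=> x Ux; apply: continuous_comp; [exact: cL|exact: (C_order_continuous (Ux : U (L x)) Cf)].
- move=> x Ux; apply: continuous_comp; [exact: cL|exact: (C_order_continuous (Ux : U (L x)) Cf)].
move=> v.
have E x : (fun h => h^-1 *: ((f \o L \o shift x) (h *: v) - (f \o L) x)) =
    (fun h => h^-1 *: ((f \o shift (L x)) (h *: L v) - f (L x))).
  by apply/funext => h /=; rewrite linearP.
split.
  by move=> x Ux; rewrite /derivable E; exact: C_order_derivable (Ux : U (L x)) Cf.
have -> : 'D_v (f \o L) = 'D_(L v) f \o L.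
  by apply/funext => x; rewrite /derive E.
exact/IH/C_order_derive.
Qed.

End Linear.

(** * Linearity of the derivative in the direction, and the mean value theorem *)

Section Directional.
Variables (R : realType) (V : normedModType R).
Implicit Types (U : set V) (f : V -> R) (u v x : V).

Lemma is_derive_line f x v t : derivable f (t *: v + x) v ->
  is_derive t 1 (fun t : R => f (t *: v + x)) ('D_v f (t *: v + x)).
Proof.
move=> df.
have E : (fun h : R => h^-1 *: (((fun t : R => f (t *: v + x)) \o shift t) (h *: 1)
   - f (t *: v + x))) =
    (fun h => h^-1 *: ((f \o shift (t *: v + x)) (h *: v) - f (t *: v + x))).
  by apply/funext => h /=; rewrite scalerDl addrA [h *: 1]mulr1.
split; first by rewrite /derivable E.
by rewrite /derive E.
Qed.

Lemma MVT_line f x v :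
  (forall t : R, 0 <= t <= 1 -> derivable f (t *: v + x) v) ->
  exists2 t : R, 0 <= t <= 1 & f (v + x) - f x = 'D_v f (t *: v + x).
Proof.
move=> df.
have dl (t : R) : t \in `[0, 1] -> is_derive t 1 (fun t : R => f (t *: v + x))
    ('D_v f (t *: v + x)).
  by rewrite in_itv/= => t01; apply/is_derive_line/df.
have H1 (t : R) : t \in `]0, 1[ -> is_derive t 1 (fun t : R => f (t *: v + x))
    ('D_v f (t *: v + x)) by move=> /subset_itv_oo_cc /dl.
have H2 : {within `[0, 1], continuous (fun t : R => f (t *: v + x))}.
  by apply: derivable_within_continuous => t /dl [].
have [c c01] := MVT_segment ler01 H1 H2.
rewrite scale1r scale0r add0r subr0 mulr1 => ->.
by exists c => //; move: c01; rewrite in_itv.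
Qed.

Lemma is_deriveZv f x v (a : R) : derivable f x v ->
  is_derive x (a *: v) f (a * 'D_v f x).
Proof.
move=> df.
have [->|a0] := eqVneq a 0.
  by rewrite scale0r mul0r; exact: is_derive0.
have E (h : R) : h^-1 *: ((f \o shift x) (h *: (a *: v)) - f x) =
    a * ((a * h)^-1 *: ((f \o shift x) ((a * h) *: v) - f x)).
  rewrite scalerA [h * a]mulrC /=.
  have [->|h0] := eqVneq h 0; first by rewrite !(mulr0, invr0, scale0r).
  by rewrite /GRing.scale/=; field; rewrite h0 a0.
have ca : h^-1 *: ((f \o shift x) (h *: (a *: v)) - f x) @[h --> 0^'] --> a * 'D_v f x.
  have /cvgrPdist_lt cg : a * (h^-1 *: ((f \o shift x) (h *: v) - f x)) @[h --> 0^'] -->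
    a * 'D_v f x by apply: cvgMl_tmp; exact: df.
  apply/cvgrPdist_lt => e /cg[d /= d0 Hd].
  near=> h; rewrite E; apply: (Hd (a * h)).
    rewrite /= sub0r normrN normrM mulrC -ltr_pdivlMr ?normr_gt0//.
    by near: h; apply: dnbhs0_lt; rewrite divr_gt0 ?normr_gt0.
  by rewrite mulf_neq0//; near: h; exact: nbhs_dnbhs_neq.
split; last by apply: cvg_lim.
by apply/cvg_ex; exists (a * 'D_v f x).
Unshelve. all: by end_near. Qed.

(** The increment is split along h u and then h v. The second piece is taken at the moving base
    point h u + x, where the mean value theorem turns it into a value of ['D_v f] near x; continuity
    of ['D_v f] at x concludes. *)
Lemma is_deriveDv U f x u v : open U -> U x -> C_order 1 U f ->
  is_derive x (u + v) f ('D_u f x + 'D_v f x).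
Proof.
move=> oU Ux Cf.
have dfx w y : U y -> derivable f y w by move=> Uy; exact: C_order_derivable Uy Cf.
have cf := C_order_continuous Ux (C_order_derive v Cf).
pose rest (h : R) := h^-1 * (f (h *: v + (h *: u + x)) - f (h *: u + x)).
have E : (fun h : R => h^-1 *: ((f \o shift x) (h *: (u + v)) - f x)) =
  (fun h : R => h^-1 *: ((f \o shift x) (h *: u) - f x) + rest h).
  apply/funext => h /=; rewrite /rest.
  have -> : h *: (u + v) + x = h *: v + (h *: u + x).
    by rewrite scalerDr addrAC addrC.
  by rewrite /GRing.scale/=; ring.
have rc : rest h @[h --> 0^'] --> 'D_v f x.
  apply/cvgrPdist_lt => e e0.
  have /cvgrPdist_lt/(_ _ e0)/nbhs_ballP[d1 d10 fd1] := cf.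
  have /nbhs_ballP[d2 d20 Ud2] := open_nbhs_nbhs (conj oU Ux).
  pose d := Num.min d1 d2.
  have d0 : 0 < d by rewrite lt_min d10 d20.
  (* For |h| < d / K all points x + h u + t h v with 0 <= t <= 1 lie in the ball of radius d; the
     summand 1 keeps K positive. *)
  pose K := `|u| + `|v| + 1.
  have K0 : 0 < K by rewrite ltr_wpDl// addr_ge0.
  have bd (h t : R) : `|h| < d / K -> 0 <= t <= 1 ->
      ball x d (t *: (h *: v) + (h *: u + x)).
    move=> hd /andP[t0 t1]; rewrite -ball_normE/=.
    rewrite distrC addrA addrK.
    rewrite (le_lt_trans (ler_normD _ _))// !normrZ (ger0_norm t0).
    rewrite ltr_pdivlMr// in hd; apply: le_lt_trans hd.
    rewrite /K !mulrDr mulr1.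
    have H1 : t * (`|h| * `|v|) <= `|h| * `|v| by rewrite ler_piMl// mulr_ge0.
    have H2 : 0 <= `|h| by [].
    lra.
  near=> h.
  have hd : `|h| < d / K.
    by near: h; apply: dnbhs0_lt; rewrite divr_gt0.
  have h0 : h != 0 by near: h; exact: nbhs_dnbhs_neq.
  have [|t t01 ft] := @MVT_line f (h *: u + x) (h *: v).
    move=> t t01; apply: dfx; apply: Ud2; apply: le_ball (bd _ _ hd t01).
    by rewrite ge_min lexx orbT.
  rewrite /rest ft.
  have By := bd _ _ hd t01.
  have Uy : U (t *: (h *: v) + (h *: u + x)).
    by apply: Ud2; apply: le_ball By; rewrite ge_min lexx orbT.
  have [_ ->] := is_deriveZv h (dfx v _ Uy).
  rewrite mulKf//; apply: fd1; apply: le_ball By.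
  by rewrite ge_min lexx.
have ca : h^-1 *: ((f \o shift x) (h *: (u + v)) - f x) @[h --> 0^'] -->
    'D_u f x + 'D_v f x.
  by rewrite E; apply: cvgD rc; exact: dfx.
split; last by apply: cvg_lim.
by apply/cvg_ex; eexists; exact: ca.
Unshelve. all: by end_near. Qed.

Lemma is_derive_sumv U f x (I : Type) (r : seq I) (w : I -> V) :
  open U -> U x -> C_order 1 U f ->
  is_derive x (\sum_(i <- r) w i) f (\sum_(i <- r) 'D_(w i) f x).
Proof.
move=> oU Ux Cf; elim: r => [|i r [dr IH]].
  by rewrite !big_nil; exact: is_derive0.
by rewrite !big_cons -IH; exact: (is_deriveDv _ _ oU).
Qed.

End Directional.

Lemma cvg_bigsum (R : realType) (T : Type) (F : set_system T) (FF : Filter F)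
    (I : Type) (r : seq I) (f : I -> T -> R) (l : I -> R) :
  (forall i, f i t @[t --> F] --> l i) ->
  (\sum_(i <- r) f i t) @[t --> F] --> \sum_(i <- r) l i.
Proof.
move=> fl; elim: r => [|i r IH].
  by under eq_cvg do rewrite big_nil; rewrite big_nil; exact: cvg_cst.
by under eq_cvg do rewrite big_cons; rewrite big_cons; exact: cvgD.
Qed.

Section Coordinates.
Variables (R : realType) (m : nat).
Implicit Types (U : set 'rV[R]_m) (f : 'rV[R]_m -> R).

Lemma is_derive_partial U f x v : open U -> U x -> C_order 1 U f ->
  is_derive x v f (\sum_i v 0 i * partial i f x).
Proof.
move=> oU Ux Cf; rewrite [v in is_derive _ v](row_sum_delta v).
rewrite (eq_bigr (fun i => 'D_(v 0 i *: delta_mx 0 i) f x)).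
  exact: (is_derive_sumv _ _ oU).
move=> i _; have [_ ->//] := is_deriveZv (v 0 i) (C_order_derivable (v := delta_mx 0 i) Ux Cf).
Qed.

Lemma cvg_rV (T : Type) (F : set_system T) (FF : Filter F) (w : T -> 'rV[R]_m) (l : 'rV[R]_m) :
  (forall i, w t 0 i @[t --> F] --> l 0 i) -> w t @[t --> F] --> l.
Proof.
move=> cw; apply/cvgrPdist_le => e e0; near=> t.
rewrite [leLHS]/Num.Def.normr/= mx_normrE (bigmax_le _ (ltW e0))//= => i _.
rewrite !mxE/= [i.1]ord1.
move: i; near: t; apply: filter_forall => /= i.
exact: (cvgrPdist_le _ _).1 (cw i.2) _ e0.
Unshelve. all: by end_near. Qed.

Lemma MVT_partial f x y (U : set 'rV[R]_m) : open U -> C_order 1 U f ->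
  (forall t : R, 0 <= t <= 1 -> U (t *: (y - x) + x)) ->
  exists2 t : R, 0 <= t <= 1 &
    f y - f x = \sum_i (y 0 i - x 0 i) * partial i f (t *: (y - x) + x).
Proof.
move=> oU Cf seg; have [t t01|t t01] := @MVT_line _ _ f x (y - x).
  exact: C_order_derivable (seg t t01) Cf.
rewrite subrK => ->; exists t => //.
have [_ ->] := is_derive_partial (y - x) oU (seg t t01) Cf.
by apply: eq_bigr => i _; rewrite !mxE.
Qed.

End Coordinates.

(** * The chain rule *)

Section Chain.
Variables (R : realType) (m : nat) (V : normedModType R).
Implicit Types (U : set V) (W : set 'rV[R]_m) (f : 'rV[R]_m -> R) (w : V -> 'rV[R]_m).

Lemma is_derive_chain W f w (x v : V) (dw : 'I_m -> R) :
  open W -> W (w x) -> C_order 1 W f -> {for x, continuous w} ->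
  (forall i, is_derive x v (fun y => w y 0 i) (dw i)) ->
  is_derive x v (fun y => f (w y)) (\sum_i dw i * partial i f (w x)).
Proof.
move=> oW Wx Cf cw dwi.
have /nbhs_ballP[d d0 Wd] := open_nbhs_nbhs (conj oW Wx).
have seg y (t : R) : 0 <= t <= 1 -> `|t *: (y - w x)| <= `|y - w x|.
  by move=> /andP[t0 t1]; rewrite normrZ ger0_norm// ler_piMl.
have cl : w (h *: v + x) @[h --> (0 : R)] --> w x.
  have c0 : h *: v + x @[h --> (0 : R)] --> 0 *: v + x.
    by apply: cvgD; [exact: scalel_continuous|exact: cvg_cst].
  rewrite scale0r add0r in c0.
  exact: (cvg_comp _ _ c0 cw).
(* [xi h] is a mean value point on the segment between the two values of w. Where the segment may
   leave W it defaults to [w x], so that the bound giving [xi h --> w x] holds for every h. *)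
have /choice[xi Hxi] : forall h : R, exists z, `|z - w x| <= `|w (h *: v + x) - w x| /\
    (`|w (h *: v + x) - w x| < d -> f (w (h *: v + x)) - f (w x) =
      \sum_i (w (h *: v + x) 0 i - w x 0 i) * partial i f z).
  move=> h; have [hd|] := ltP `|w (h *: v + x) - w x| d; last first.
    by move=> _; exists (w x); rewrite subrr normr0.
  have [t t01|t t01 ft] := @MVT_partial _ _ f (w x) (w (h *: v + x)) _ oW Cf.
    apply: Wd; rewrite -ball_normE/= distrC addrK.
    exact: le_lt_trans (seg _ _ t01) hd.
  by exists (t *: (w (h *: v + x) - w x) + w x); rewrite addrK; split => //; exact: seg.
have cl' : w (h *: v + x) @[h --> (0 : R)^'] --> w x.
  exact: cvg_within_filter cl.
have cxi : xi h @[h --> 0^'] --> w x.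
  apply/cvgrPdist_lt => e e0.
  have H := (cvgrPdist_lt _ _).1 cl' _ e0.
  near=> h; rewrite distrC; apply: le_lt_trans (Hxi h).1 _.
  by rewrite distrC; near: h; exact: H.
have cdf : (\sum_i (h^-1 *: (w (h *: v + x) 0 i - w x 0 i)) * partial i f (xi h))
    @[h --> 0^'] --> \sum_i dw i * partial i f (w x).
  apply: cvg_bigsum => i; apply: cvgM.
    by have [+ <-] := dwi i; apply.
  apply: (@cvg_comp _ _ _ xi (partial i f)) cxi _.
  exact: C_order_continuous Wx (C_order_derive _ Cf).
have ca : h^-1 *: (((fun y => f (w y)) \o shift x) (h *: v) - f (w x)) @[h --> 0^'] -->
    \sum_i dw i * partial i f (w x).
  apply: cvg_trans cdf; apply: near_eq_cvg.
  have H := (cvgrPdist_lt _ _).1 cl' _ d0.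
  near=> h; rewrite /= (Hxi h).2; last by rewrite distrC; near: h; exact: H.
  by rewrite scaler_sumr; apply: eq_bigr => i _; rewrite scalerAl.
split; last exact: cvg_lim.
by apply/cvg_ex; eexists; exact: ca.
Unshelve. all: by end_near. Qed.

Lemma C_order_rV_continuous n U w x : U x ->
  (forall i, C_order n U (fun y => w y 0 i)) -> {for x, continuous w}.
Proof.
move=> Ux Cw; apply: cvg_rV => i; exact: (C_order_continuous Ux (Cw i)).
Qed.

Lemma C_order_comp n U W f w : open U -> open W -> (forall x, U x -> W (w x)) ->
  (forall i, C_order n U (fun y => w y 0 i)) -> C_order n W f ->
  C_order n U (fun y => f (w y)).
Proof.
move=> oU oW UW; elim: n f => [|n IH] f Cw Cf.
  split => // x Ux; apply: (@continuous_comp _ _ _ w f).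
    exact: C_order_rV_continuous Ux Cw.
  exact: C_order_continuous (UW x Ux) Cf.
have cw x : U x -> {for x, continuous w}.
  by move=> Ux; exact: C_order_rV_continuous Ux Cw.
have Cf1 : C_order 1 W f.
  by have [c d] := Cf; split => // v; split; [exact: (d v).1|
    split => // x Wx; exact: (C_order_continuous Wx (d v).2)].
apply: (@C_orderI _ _ _ _ _
  (fun v x => \sum_i 'D_v (fun y => w y 0 i) x * partial i f (w x))) => //.
- move=> x Ux; apply: (@continuous_comp _ _ _ w f); first exact: cw.
  exact: C_order_continuous (UW x Ux) Cf.
- move=> x v Ux; apply: (@is_derive_chain W) => //; [exact: UW|exact: cw|].
  by move=> i; apply: derivableP; exact: C_order_derivable Ux (Cw i).
- move=> v; apply: C_order_sum => // i _; apply: C_orderM => //.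
    exact: C_order_derive (Cw i).
  apply: IH; first by move=> j; exact: C_orderW (Cw j).
  exact: C_order_derive Cf.
Qed.

End Chain.

Section Scalars.
Variable R : realType.

Lemma C_order_id n (U : set R) : C_order n U (fun x : R => x).
Proof.
case: n => [|n]; split => //; try by move=> x _; exact: cvg_id.
move=> v; split; first by move=> x _; exact: derivable_id.
rewrite (_ : 'D_v _ = cst v); first exact: C_order_cst.
by apply/funext => x; exact: derive_id.
Qed.

(** Named so that it can carry a linear structure and be fed to [C_order_comp_linear]. *)
Definition coord_rV m (i : 'I_m) (x : 'rV[R]_m) : R := x 0 i.

Lemma coord_rV_is_linear m (i : 'I_m) : linear (@coord_rV m i).
Proof. by move=> a u v; rewrite /coord_rV !mxE. Qed.

HB.instance Definition _ m (i : 'I_m) :=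
  GRing.isLinear.Build R 'rV[R]_m R _ _ (@coord_rV_is_linear m i).

Lemma C_order_coord n m (U : set 'rV[R]_m) (i : 'I_m) :
  C_order n U (fun x => x 0 i).
Proof.
have := @C_order_comp_linear _ _ _ n setT (fun x : R => x) (@coord_rV m i).
rewrite preimage_setT => H; apply: (C_order_sub (subsetT U)); apply: H.
  exact: coord_continuous.
exact: C_order_id.
Qed.

Lemma C_order_comp1 (V : normedModType R) n (U : set V) (W : set R) (f : R -> R)
  (w : V -> R) : open U -> open W -> (forall x, U x -> W (w x)) ->
  C_order n U w -> C_order n W f -> C_order n U (fun y => f (w y)).
Proof.
move=> oU oW UW Cw Cf.
pose L : {linear 'rV[R]_1 -> R} := @coord_rV 1 0.
have cL : continuous L by exact: coord_continuous.
have E y : w y = L (\row_(_ < 1) w y) by rewrite /L/= /coord_rV mxE.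
rewrite (_ : (fun y => f (w y)) = (fun y => (f \o L) (\row_(_ < 1) w y))); last first.
  by apply/funext => y /=; rewrite -E.
apply: (@C_order_comp _ _ _ _ _ (L @^-1` W)) => //.
- by apply: open_comp => // x _; exact: cL.
- by move=> x Ux; rewrite /preimage/= -E; exact: UW.
- by move=> i; rewrite (_ : (fun y => _) = w)//; apply/funext => y; rewrite mxE.
exact: C_order_comp_linear.
Qed.

Lemma C_orderV (V : normedModType R) n (U : set V) (f : V -> R) : open U ->
  (forall x, U x -> f x != 0) -> C_order n U f -> C_order n U (fun y => (f y)^-1).
Proof.
move=> oU f0; elim: n => [|n IH] Cf.
  split => // x Ux; apply: cvgV; first exact: f0.
  exact: (C_order_continuous Ux Cf).
apply: (@C_orderI _ _ _ _ _ (fun v x => (-1 * ((f x)^-1 * (f x)^-1)) * 'D_v f x)) => //.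
- move=> x Ux; apply: cvgV; first exact: f0.
  exact: (C_order_continuous Ux Cf).
- move=> x v Ux.
  have df := C_order_derivable (v := v) Ux Cf.
  split; first exact: derivableV (f0 x Ux) df.
  by rewrite (deriveV (f0 x Ux) df) -exprVn expr2 mulN1r.
- move=> v; apply: C_orderM => //; last exact: C_order_derive.
  apply: C_orderM => //; first exact: C_order_cst.
  by apply: C_orderM => //; apply: IH; exact: C_orderW.
Qed.

(** With e = 1 or e = -1 this covers |x|^a on either side of 0 at once. *)
Lemma C_order_powR n (e a : R) :
  C_order n [set x | 0 < e * x] (fun x => (e * x) `^ a).
Proof.
have op : open [set x : R | 0 < x] by exact: open_gt.
have H : C_order n [set x : R | 0 < x] (fun x => x `^ a).
  elim: n a => [|n IH] a.
    split => // x /= x0; apply/differentiable_continuous/derivable1_diffP.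
    by have [] := is_derive1_powR a x0.
  apply: (@C_orderI _ _ _ _ _ (fun v x : R => v * (a * x `^ (a - 1)))) => //.
  - move=> x /= x0; apply/differentiable_continuous/derivable1_diffP.
    by have [] := is_derive1_powR a x0.
  - move=> x v /= x0; have [d E] := is_derive1_powR a x0.
    by have := is_deriveZv v d; rewrite E /GRing.scale/= mulr1.
  - by move=> v; do 2! [apply: C_orderM => //; first exact: C_order_cst].
have oe : open [set x : R | 0 < e * x].
  apply: (@open_comp _ _ ( *%R e) [set x : R | 0 < x]) => // x _.
  exact: mulrl_continuous.
apply: (@C_order_comp1 _ n _ [set x : R | 0 < x] (fun y => y `^ a) (fun x => e * x)) => //.
by apply: C_orderM => //; [exact: C_order_cst|exact: C_order_id].
Qed.

End Scalars.

(** * Hadamard's lemma and the second-order Taylor formula *)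

Section UnitMean.
Variable R : realType.
Implicit Types phi psi dphi : R -> R.

Definition unit_mean phi : R := (\int[lebesgue_measure]_(t in `[0%R, 1%R]) phi t)%R.

Lemma integrable_unit phi : continuous phi ->
  (@lebesgue_measure R).-integrable `[0%R, 1%R] (EFin \o phi).
Proof.
move=> cphi; apply: continuous_compact_integrable; first exact: segment_compact.
exact: continuous_subspaceT.
Qed.

Lemma measurable_unit : measurable (`[0%R, 1%R]%classic : set (measurableTypeR R)).
Proof. exact: measurable_itv. Qed.

Lemma unit_meanD phi psi : continuous phi -> continuous psi ->
  unit_mean (fun t => phi t + psi t) = unit_mean phi + unit_mean psi.
Proof.
by move=> c1 c2; rewrite /unit_mean RintegralD//; exact: integrable_unit.
Qed.

Lemma unit_meanB phi psi : continuous phi -> continuous psi ->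
  unit_mean (fun t => phi t - psi t) = unit_mean phi - unit_mean psi.
Proof.
by move=> c1 c2; rewrite /unit_mean RintegralB//; exact: integrable_unit.
Qed.

Lemma unit_meanZ (a : R) phi : continuous phi ->
  unit_mean (fun t => a * phi t) = a * unit_mean phi.
Proof. by move=> c1; rewrite /unit_mean RintegralZl//; exact: integrable_unit. Qed.

Lemma unit_mean_cst (a : R) : unit_mean (fun=> a) = a.
Proof.
rewrite /unit_mean Rintegral_cst//= lebesgue_measure_itv/= lte_fin ltr01.
by rewrite oppr0 adde0/= mulr1.
Qed.

Lemma norm_unit_mean_le phi (e : R) : continuous phi ->
  (forall t, 0 <= t <= 1 -> `|phi t| <= e) -> `|unit_mean phi| <= e.
Proof.
move=> cphi phie.
apply: (le_trans (le_normr_Rintegral measurable_unit (integrable_unit cphi))).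
rewrite -[leRHS]unit_mean_cst; apply: le_Rintegral => //.
- apply: (integrable_unit (phi := fun t => `|phi t|)) => t.
  by apply: cvg_norm; exact: cphi.
- by apply: integrable_unit => t; exact: cvg_cst.
Qed.

Lemma unit_mean_derive phi dphi : (forall t : R, is_derive t 1 phi (dphi t)) ->
  continuous dphi -> unit_mean dphi = phi 1 - phi 0.
Proof.
move=> dp cd.
have cphi : continuous phi.
  by move=> t; apply/differentiable_continuous/derivable1_diffP; have [] := dp t.
have := @continuous_FTC2 R dphi phi 0 1 ltr01.
rewrite /unit_mean /Rintegral => ->//.
- exact: continuous_subspaceT.
- split; first by move=> t _; have [] := dp t.
    exact: cvg_at_right_filter (cphi 0).
  exact: cvg_at_left_filter (cphi 1).
- by move=> t _; rewrite derive1E; have [] := dp t.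
Qed.

End UnitMean.

Section RayMean.
Variables (R : realType) (V : normedModType R).
Implicit Types h : V -> R.

(** For j = 0 and h a partial derivative of f this is the coefficient in Hadamard's lemma. The
    weight t^j is there because differentiating h(t x) in x produces a factor t. *)
Definition ray_mean (j : nat) h (x : V) : R :=
  unit_mean (fun t => t ^+ j * h (t *: x)).

Lemma continuous_ray h (x : V) j : continuous h ->
  continuous (fun t : R => t ^+ j * h (t *: x)).
Proof.
move=> ch t; apply: cvgM; first exact: exprn_continuous.
apply: (@continuous_comp _ _ _ (fun t : R => t *: x) h); last exact: ch.
exact: scalel_continuous.
Qed.

(** Compactness of the unit interval makes the estimate uniform in t. It replaces a dominated
    convergence argument for the integrals below. *)
Lemma ray_uniform h (x : V) (e : R) : continuous h -> 0 < e ->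
  \forall y \near x, forall t : R, 0 <= t <= 1 -> `|h (t *: y) - h (t *: x)| < e.
Proof.
move=> ch e0.
have := @segment_compact R 0 1.
move=> /compact_near_coveringP/(_ V (nbhs x)
  (fun y t => `|h (t *: y) - h (t *: x)| < e)) H.
apply: filterS (H _ _) => [y Hy t t01|t _].
  by apply: Hy; rewrite /= in_itv.
have c1 : h (z.1 *: z.2) @[z --> (t, x)] --> h (t *: x).
  exact: (cvg_comp _ _ (@scale_continuous _ _ (t, x)) (ch (t *: x))).
have c2 : h (z.1 *: x) @[z --> (t, x)] --> h (t *: x).
  apply: (cvg_comp (fun z : R * V => z.1 *: x) h _ (ch (t *: x))).
  by apply: cvgZr_tmp; exact: cvg_fst.
have c3 : h (z.1 *: z.2) - h (z.1 *: x) @[z --> (t, x)] --> (0 : R).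
  by rewrite -(subrr (h (t *: x))); exact: cvgB.
have := (cvgrPdist_lt _ _).1 c3 _ e0.
case=> -[A B] /= [At Bx] AB; exists (A, B) => //= z ABz.
by have := AB z ABz; rewrite /= sub0r normrN.
Qed.

Lemma ray_mean_continuous j h : continuous h -> continuous (ray_mean j h).
Proof.
move=> ch x; apply/cvgrPdist_le => e e0.
have := ray_uniform x ch e0; apply: filterS => y Hy.
rewrite /ray_mean -unit_meanB; [|exact: continuous_ray..].
apply: norm_unit_mean_le => [t|t t01].
  by apply: cvgB; exact: continuous_ray.
rewrite -mulrBr normrM distrC -[leRHS]mul1r ler_pM//; last exact/ltW/Hy.
by move/andP: t01 => [t0 t1]; rewrite normrX ger0_norm// exprn_ile1.
Qed.

(** Differentiation under the integral sign: by the mean value theorem the integrand of the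
    difference quotient differs from the expected one by t^(j+1) times an increment of ['D_v h]
    along rays, which [ray_uniform] makes small for all t together. *)
Lemma ray_mean_is_derive j h x v : C_order 1 setT h ->
  is_derive x v (ray_mean j h) (ray_mean j.+1 ('D_v h) x).
Proof.
move=> Ch.
have dh y w : derivable h y w by exact: (C_order_derivable _ Ch).
have ch : continuous h by move=> y; exact: (C_order_continuous _ Ch).
have cd : continuous ('D_v h).
  by move=> y; exact: (C_order_continuous _ (C_order_derive v Ch)).
have ca : s^-1 *: ((ray_mean j h \o shift x) (s *: v) - ray_mean j h x) @[s --> 0^'] -->
    ray_mean j.+1 ('D_v h) x.
  apply/cvgrPdist_le => e e0.
  have /nbhs_ballP[d d0 Hd] := ray_uniform x cd e0.
  near=> s.
  have s0 : s != 0 by near: s; exact: nbhs_dnbhs_neq.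
  have sd : `|s| * (`|v| + 1) < d.
    rewrite -ltr_pdivlMr ?ltr_wpDl//.
    by near: s; apply: dnbhs0_lt; rewrite divr_gt0// ltr_wpDl.
  have cj (y : V) k (g : V -> R) : continuous g -> continuous (fun t : R => t ^+ k * g (t *: y)).
    exact: continuous_ray.
  have cB : continuous (fun t : R =>
      t ^+ j * h (t *: (s *: v + x)) - t ^+ j * h (t *: x)).
    by move=> t; apply: cvgB; exact: cj.
  have -> : s^-1 *: ((ray_mean j h \o shift x) (s *: v) - ray_mean j h x) =
      unit_mean (fun t => s^-1 * (t ^+ j * h (t *: (s *: v + x)) - t ^+ j * h (t *: x))).
    by rewrite unit_meanZ// unit_meanB//; exact: cj.
  rewrite distrC /ray_mean -unit_meanB; last 2 first.
  - by move=> t; apply: cvgMl_tmp; exact: cB.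
  - exact: (cj x _ _ cd).
  apply: norm_unit_mean_le => [t|t t01].
    by apply: cvgB; [apply: cvgMl_tmp; exact: cB|exact: (cj x _ _ cd)].
  have [|th th01 E] := @MVT_line _ _ h (t *: x) ((t * s) *: v).
    by move=> ? _; exact: dh.
  (* The mean value point is t times a point near x, as [ray_uniform] requires, and the factor t
     raises the weight from j to j + 1. *)
  have {}E : h (t *: (s *: v + x)) - h (t *: x) =
      t * s * 'D_v h (t *: ((th * s) *: v + x)).
    rewrite scalerDr scalerA E.
    have [_ ->] := is_deriveZv (t * s) (dh (th *: ((t * s) *: v) + t *: x) v).
    by rewrite scalerDr !scalerA mulrCA.
  rewrite -mulrBr E.
  rewrite (_ : _ - _ = t ^+ j.+1 *
     ('D_v h (t *: ((th * s) *: v + x)) - 'D_v h (t *: x))); last first.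
    by rewrite exprS; field.
  rewrite normrM -[leRHS]mul1r ler_pM//.
    by move/andP: t01 => [t0 t1]; rewrite normrX ger0_norm// exprn_ile1.
  apply: ltW; apply: Hd => //; rewrite -ball_normE/= distrC addrK.
  apply: le_lt_trans sd; rewrite normrZ normrM.
  move/andP: th01 => [th0 th1]; rewrite (ger0_norm th0) -mulrA.
  apply: le_trans (_ : `|s| * `|v| <= _); first by rewrite ler_piMl.
  by rewrite ler_pM// lerDl.
split; last exact: cvg_lim.
by apply/cvg_ex; eexists; exact: ca.
Unshelve. all: by end_near. Qed.

Lemma C_order_ray_mean n j h : (forall k, C_order k setT h) ->
  C_order n setT (ray_mean j h).
Proof.
elim: n j h => [|n IH] j h Ch.
  split => // x _; apply: ray_mean_continuous => y.
  exact: (C_order_continuous _ (Ch 0)).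
apply: (@C_orderI _ _ _ _ _ (fun v => ray_mean j.+1 ('D_v h))).
- exact: openT.
- move=> x _; apply: ray_mean_continuous => y.
  exact: (C_order_continuous _ (Ch 0)).
- by move=> x v _; exact: ray_mean_is_derive.
- by move=> v; apply: IH => k; exact: C_order_derive.
Qed.

Lemma ray_mean0 h : ray_mean 0 h 0 = h 0.
Proof.
rewrite /ray_mean (_ : (fun t => _) = fun=> h 0) ?unit_mean_cst//.
by apply/funext => t; rewrite mul1r scaler0.
Qed.

End RayMean.

Section Hadamard.
Variables (R : realType).

Lemma is_derive_bigsum (V : normedModType R) (I : Type) (r : seq I) (F : I -> V -> R)
    (dF : I -> R) (x v : V) : (forall i, is_derive x v (F i) (dF i)) ->
  is_derive x v (fun y => \sum_(i <- r) F i y) (\sum_(i <- r) dF i).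
Proof.
move=> dFi; elim: r => [|i r IH].
  rewrite big_nil (_ : (fun y => _) = cst 0); first exact: is_derive_cst.
  by apply/funext => y; rewrite big_nil.
rewrite big_cons (_ : (fun y => _) = (fun y => F i y + \sum_(j <- r) F j y)).
  exact: is_deriveD.
by apply/funext => y; rewrite big_cons.
Qed.

Lemma is_derive_coord m (x v : 'rV[R]_m) (k : 'I_m) :
  is_derive x v (fun y => y 0 k) (v 0 k).
Proof.
have dk : derivable (@id 'rV[R]_m) x v by exact: derivable_id.
split; first exact: ((derivable_mxP id x v).1 dk 0 k).
by have := derive_mx dk; rewrite derive_id => /matrixP/(_ 0 k); rewrite !mxE.
Qed.

Lemma unit_mean_sum (I : Type) (r : seq I) (F : I -> R -> R) :
  (forall i, continuous (F i)) ->
  unit_mean (fun t => \sum_(i <- r) F i t) = \sum_(i <- r) unit_mean (F i).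
Proof.
move=> cF; elim: r => [|i r IH].
  rewrite big_nil (_ : (fun y => _) = cst 0) ?unit_mean_cst//.
  by apply/funext => y; rewrite big_nil.
rewrite big_cons (_ : (fun y => _) = (fun y => F i y + \sum_(j <- r) F j y)).
  rewrite unit_meanD ?IH// => t.
  by apply: cvg_bigsum => j; exact: cF.
by apply/funext => y; rewrite big_cons.
Qed.

Variable m : nat.
Implicit Types f : 'rV[R]_m -> R.

(** Integrate the derivative of t |-> f(t x) over the unit interval. *)
Lemma hadamard f x : (forall n, C_order n setT f) ->
  f x = f 0 + \sum_i x 0 i * ray_mean 0 (partial i f) x.
Proof.
move=> Cf.
have cp i : continuous (partial i f).
  by move=> y; exact: (C_order_continuous _ (C_order_derive _ (Cf 1))).
have cr (i : 'I_m) : continuous (fun t : R => t ^+ 0 * partial i f (t *: x)).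
  exact: continuous_ray.
have dphi (t : R) : is_derive t 1 (fun t => f (t *: x))
    (\sum_i x 0 i * (t ^+ 0 * partial i f (t *: x))).
  have := @is_derive_line _ _ f 0 x t.
  rewrite addr0 (_ : (fun t : R => _) = (fun t : R => f (t *: x))); last first.
    by apply/funext => s; rewrite addr0.
  have [dx _] := is_derive_partial x openT (I : setT (t *: x)) (Cf 1).
  move=> /(_ dx).
  have [_ ->] := is_derive_partial x openT (I : setT (t *: x)) (Cf 1).
  by under [X in _ -> is_derive _ _ _ X]eq_bigr do rewrite expr0 mul1r.
have := unit_mean_derive dphi; rewrite scale1r scale0r => H.
rewrite -[LHS](subrK (f 0)) addrC -H; last first.
  by move=> t; apply: cvg_bigsum => i; apply: cvgMl_tmp; exact: cr.
congr (_ + _); rewrite unit_mean_sum; last first.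
  by move=> i t; apply: cvgMl_tmp; exact: cr.
by apply: eq_bigr => i _; rewrite unit_meanZ//; exact: cr.
Qed.

Lemma C_order_ray_mean_partial f i n : (forall n, C_order n setT f) ->
  C_order n setT (ray_mean 0 (partial i f)).
Proof.
by move=> Cf; apply: C_order_ray_mean => k; exact: C_order_derive (Cf k.+1).
Qed.

(** The factor 1/2 is the integral of the weight t produced by [ray_mean_is_derive]; at x = 0 the
    rest of the integrand is constant. *)
Lemma partial_ray_mean f i j : (forall n, C_order n setT f) ->
  partial j (ray_mean 0 (partial i f)) 0 = 2^-1 * d2 f j i.
Proof.
move=> Cf.
have [_ +] := @ray_mean_is_derive _ _ 0 _ 0 (delta_mx 0 j)
   (C_order_derive (delta_mx 0 i) (Cf 2)).
rewrite /partial => ->; rewrite /ray_mean.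
rewrite (_ : (fun t => _) = (fun t => d2 f j i * t)); last first.
  by apply/funext => t; rewrite expr1 scaler0 mulrC.
rewrite unit_meanZ; last by move=> t; exact: cvg_id.
have H (t : R) : is_derive t 1 (fun t : R => 2^-1 * (t * t)) t.
  have d := is_derive_id t (1 : R).
  have [dt E] := is_deriveM (is_derive_cst (2^-1 : R) t 1) (is_deriveM d d).
  split; first exact: dt.
  by rewrite [LHS]E /GRing.scale/=; lra.
rewrite (unit_mean_derive H); last by move=> t; exact: cvg_id.
by rewrite !mulr1 !mulr0 subr0 mulrC.
Qed.

Lemma sum_deltaM (i : 'I_m) (F : 'I_m -> R) : \sum_k (k == i)%:R * F k = F i.
Proof.
rewrite (bigD1 i)//= eqxx mul1r big1 ?addr0// => k /negbTE ->.
by rewrite mul0r.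
Qed.

(* Differentiating [f x = f 0 + \sum_k x_k g_k x] twice at 0 gives
   [d2 f i j = (d2 f i j + d2 f j i) / 2]. *)
Lemma d2_sym f i j : (forall n, C_order n setT f) -> d2 f i j = d2 f j i.
Proof.
move=> Cf.
pose g k := ray_mean 0 (partial k f).
have Cg k : C_order 2 setT (g k) by exact: C_order_ray_mean_partial.
have dg k l x : is_derive x (delta_mx 0 l) (g k) (partial l (g k) x).
  by apply: derivableP; exact: (C_order_derivable _ (Cg k)).
have ddg k l x : is_derive x (delta_mx 0 i) (partial l (g k)) (partial i (partial l (g k)) x).
  by apply: derivableP; exact: (C_order_derivable _ (C_order_derive _ (Cg k))).
have fE : f = (fun x => cst (f 0) x + \sum_k x 0 k * g k x).
  by apply/funext => x; exact: hadamard.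
have dfE : partial j f =
    (fun x => \sum_k (x 0 k * partial j (g k) x + g k x * (delta_mx 0 j : 'rV[R]_m) 0 k)).
  apply/funext => x; rewrite /partial [in LHS]fE.
  have H : is_derive x (delta_mx 0 j) (fun x : 'rV[R]_m => \sum_k x 0 k * g k x)
    (\sum_k (x 0 k * partial j (g k) x + g k x * (delta_mx 0 j : 'rV[R]_m) 0 k)).
    apply: is_derive_bigsum => k.
    exact: (is_deriveM (is_derive_coord x (delta_mx 0 j) k) (dg k j x)).
  have [_ ->] := is_deriveD (is_derive_cst (f 0) x (delta_mx 0 j)) H.
  by rewrite add0r.
have : d2 f i j = partial j (g i) 0 + partial i (g j) 0.
  rewrite /d2 dfE /partial.
  have H : is_derive (0 : 'rV[R]_m) (delta_mx 0 i) (fun x : 'rV[R]_m =>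
     \sum_k (x 0 k * partial j (g k) x + g k x * (delta_mx 0 j : 'rV[R]_m) 0 k))
    (\sum_k ((0 : 'rV[R]_m) 0 k * partial i (partial j (g k)) 0 +
       partial j (g k) 0 * (delta_mx 0 i : 'rV[R]_m) 0 k +
       (g k 0 * 0 + (delta_mx 0 j : 'rV[R]_m) 0 k * partial i (g k) 0))).
    apply: is_derive_bigsum => k; apply: is_deriveD.
      exact: (is_deriveM (is_derive_coord 0 (delta_mx 0 i) k) (ddg k j 0)).
    exact: (is_deriveM (dg k i 0) (is_derive_cst _ 0 (delta_mx 0 i))).
  have [_ ->] := H.
  transitivity (\sum_k (k == i)%:R * partial j (g k) 0 +
      \sum_k (k == j)%:R * partial i (g k) 0); last first.
    by congr (_ + _); [exact: (sum_deltaM i (fun k => partial j (g k) 0))|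
      exact: (sum_deltaM j (fun k => partial i (g k) 0))].
  rewrite -big_split/=; apply: eq_bigr => k _.
  by rewrite !mxE/= mul0r add0r mulr0 add0r mulrC.
rewrite /g (partial_ray_mean i j Cf) (partial_ray_mean j i Cf).
by move: (d2 f i j) (d2 f j i) => a b; lra.
Qed.

(** The coefficient of x_i x_j obtained by applying [hadamard] to f and once more to each of its
    coefficients. It depends smoothly on x, so the resulting second-order formula is exact. *)
Definition quad_coef f (i j : 'I_m) : 'rV[R]_m -> R :=
  ray_mean 0 (partial j (ray_mean 0 (partial i f))).

Lemma C_order_quad_coef f i j n : (forall n, C_order n setT f) ->
  C_order n setT (quad_coef f i j).
Proof.
by move=> Cf; apply: C_order_ray_mean_partial => k; exact: C_order_ray_mean_partial.
Qed.

Lemma quad_coef0 f i j : (forall n, C_order n setT f) ->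
  quad_coef f i j 0 = 2^-1 * d2 f i j.
Proof.
by move=> Cf; rewrite /quad_coef ray_mean0 (partial_ray_mean _ _ Cf) d2_sym.
Qed.

Lemma taylor_quad f x : (forall n, C_order n setT f) -> f 0 = 0 ->
  f x = \sum_i x 0 i * d1 f i + \sum_i \sum_j x 0 i * x 0 j * quad_coef f i j x.
Proof.
move=> Cf f0; rewrite [LHS]hadamard// f0 add0r -big_split/=.
apply: eq_bigr => i _.
rewrite (@hadamard (ray_mean 0 (partial i f))); last first.
  by move=> n; exact: C_order_ray_mean_partial.
rewrite ray_mean0 mulrDr mulr_sumr; congr (_ + _).
by apply: eq_bigr => j _; rewrite mulrA.
Qed.

End Hadamard.

(** * Implicit functions and blow-up *)

Section ImplicitFunction.
Variable R : realType.

Definition pt2 (z mu : R) : 'rV[R]_2 := \row_(i < 2) (if i == 0 then z else mu).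

Lemma pt2_0 z mu : pt2 z mu 0 0 = z. Proof. by rewrite mxE. Qed.
Lemma pt2_1 z mu : pt2 z mu 0 1 = mu. Proof. by rewrite mxE. Qed.

Lemma norm_rV2_lt (x : 'rV[R]_2) (e : R) : `|x 0 0| < e -> `|x 0 1| < e -> `|x| < e.
Proof.
move=> x0 x1; rewrite [ltLHS]/Num.Def.normr/= mx_normrE bigmax_lt//=.
  exact: le_lt_trans x0.
move=> [i j] _ /=; rewrite (ord1 i).
by have [->|->] : j = 0 \/ j = 1
  by case: j => -[|[|]]// ?; [left|right]; exact/val_inj.
Qed.

Lemma C_order_pt2 n (U : set R) (q : R -> R) (i : 'I_2) : C_order n U q ->
  C_order n U (fun mu => pt2 (q mu) mu 0 i).
Proof.
move=> Cq; have [->|i0] := eqVneq i 0.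
  by rewrite (_ : (fun mu => _) = q)//; apply/funext => mu; rewrite pt2_0.
rewrite (_ : (fun mu => _) = (fun mu => mu)); first exact: C_order_id.
by apply/funext => mu; rewrite mxE (negbTE i0).
Qed.

Lemma open_disk (r : R) : open [set x : R | `|x| < r].
Proof.
rewrite (_ : [set x | _] = ball (0 : R) r); first exact: ball_open.
by apply/seteqP; split => x; rewrite -ball_normE/= sub0r normrN.
Qed.

(** On a small box F is strictly increasing in z, so the intermediate value theorem gives a zero and
    monotonicity makes it the only one. Mean value estimates then show that q is Lipschitz and
    differentiable, and the formula for q' gives all higher regularity. *)
Lemma implicit_function_pos (F : 'rV[R]_2 -> R) (U : set 'rV[R]_2) (z0 : R) :
  open U -> U (pt2 z0 0) -> (forall n, C_order n U F) -> F (pt2 z0 0) = 0 ->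
  0 < partial 0 F (pt2 z0 0) ->
  exists (q : R -> R) (r : R), [/\ 0 < r, q 0 = z0,
    forall n, C_order n [set x : R | `|x| < r] q,
    forall mu, `|mu| < r -> U (pt2 (q mu) mu) /\ F (pt2 (q mu) mu) = 0 &
    forall mu z, `|mu| < r -> `|z - z0| < r -> F (pt2 z mu) = 0 -> z = q mu].
Proof.
move=> oU U0 CF F0 c0.
set P0 := pt2 z0 0 in U0 F0 c0 *.
(* Bounds with some slack, so that by continuity they persist near the point: F_z >= m and |F_mu| <=
   M. *)
pose m : R := partial 0 F P0 / 2; pose M : R := `|partial 1 F P0| + 1.
have m0 : 0 < m by rewrite /m divr_gt0.
have M0 : 0 < M by rewrite /M ltr_wpDl.
have [eta eta0 Heta] : exists2 eta : R, 0 < eta & forall y : 'rV[R]_2, `|y - P0| < eta ->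
    [/\ U y, m <= partial 0 F y & `|partial 1 F y| <= M].
  have cz := C_order_continuous U0 (C_order_derive (delta_mx 0 0) (CF 1)).
  have cm := C_order_continuous U0 (C_order_derive (delta_mx 0 1) (CF 1)).
  have /nbhs_ballP[d1 /= d10 H1] := open_nbhs_nbhs (conj oU U0).
  have /cvgrPdist_lt/(_ _ m0)/nbhs_ballP[d2 /= d20 H2] := cz.
  have /cvgrPdist_lt/(_ _ ltr01)/nbhs_ballP[d3 /= d30 H3] := cm.
  exists (Num.min d1 (Num.min d2 d3)); first by rewrite !lt_min d10 d20 d30.
  move=> y; rewrite distrC !lt_min => /andP[y1 /andP[y2 y3]].
  have By d : `|P0 - y| < d -> ball P0 d y by rewrite -ball_normE.
  split; first exact/H1/By.
    have := H2 y (By _ y2); rewrite /partial -/m /= ltr_norml => /andP[_].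
    rewrite /m /partial; set a := 'D_ _ _ _; set b := 'D_ _ _ _; lra.
  have := H3 y (By _ y3); rewrite /M /partial /= => h.
  apply: ltW; rewrite -[X in `|X|](subrK ('D_(delta_mx 0 1) F P0)) addrC.
  apply: le_lt_trans (ler_normD _ _) _; rewrite ltrD2l.
  by rewrite distrC.
pose box (z mu : R) := `|z - z0| < eta /\ `|mu| < eta.
have Bbox z mu : box z mu -> `|pt2 z mu - P0| < eta.
  by move=> [bz bm]; apply: norm_rV2_lt; rewrite !mxE//= subr0.
have Bseg (x y : 'rV[R]_2) (t : R) : `|x - P0| < eta -> `|y - P0| < eta -> 0 <= t <= 1 ->
    `|t *: (y - x) + x - P0| < eta.
  move=> bx bY /andP[t0 t1].
  rewrite (_ : _ - P0 = t *: (y - P0) + (1 - t) *: (x - P0)); last first.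
    by apply/rowP => i; rewrite !mxE; ring.
  apply: le_lt_trans (ler_normD _ _) _; rewrite !normrZ !ger0_norm ?subr_ge0//.
  have : t * `|y - P0| <= t * Num.max `|x - P0| `|y - P0|.
    by rewrite ler_wpM2l// le_max lexx orbT.
  have : (1 - t) * `|x - P0| <= (1 - t) * Num.max `|x - P0| `|y - P0|.
    by rewrite ler_wpM2l ?subr_ge0// le_max lexx.
  have : Num.max `|x - P0| `|y - P0| < eta by rewrite gt_max bx.
  set a := Num.max _ _; lra.
pose B := [set y : 'rV[R]_2 | `|y - P0| < eta].
have oB : open B.
  rewrite (_ : B = ball P0 eta); first exact: ball_open.
  by apply/seteqP; split => y; rewrite -ball_normE/B/= distrC.
have BU : B `<=` U by move=> y /Heta[].
have CFB n : C_order n B F by exact: C_order_sub (CF n).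
have key z mu z' mu' : box z mu -> box z' mu' -> exists xi,
    [/\ B xi, `|xi - pt2 z mu| <= `|pt2 z' mu' - pt2 z mu| &
    F (pt2 z' mu') - F (pt2 z mu) =
      (z' - z) * partial 0 F xi + (mu' - mu) * partial 1 F xi].
  move=> /Bbox b1 /Bbox b2.
  have [|t t01 E] := @MVT_partial _ _ F (pt2 z mu) (pt2 z' mu') B oB (CFB 1).
    by move=> t t01; exact: Bseg.
  exists (t *: (pt2 z' mu' - pt2 z mu) + pt2 z mu); split; first exact: Bseg.
    rewrite addrK normrZ; move/andP: t01 => [t0 t1].
    by rewrite ger0_norm// ler_piMl.
  rewrite E big_ord_recl big_ord1.
  have -> : lift ord0 ord0 = 1 :> 'I_2 by exact/val_inj.
  by rewrite !mxE.
pose h := eta / 2.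
have h0 : 0 < h by rewrite divr_gt0.
have heta : h < eta by rewrite /h; lra.
(* Moving z by h changes F by at least h m, while moving mu by less than r changes it by less than h
   m; the factor 2 makes this strict. Hence F has opposite signs at z0 - h and z0 + h. *)
pose r := Num.min h (h * m / (2 * M)).
have r0 : 0 < r by rewrite lt_min h0 divr_gt0// mulr_gt0.
have rh : r <= h by rewrite ge_min lexx.
have rM : r * M < h * m.
  have : r <= h * m / (2 * M) by rewrite ge_min lexx orbT.
  have hm0 : 0 < h * m by exact: mulr_gt0.
  by rewrite ler_pdivlMr ?mulr_gt0//; nra.
have uniq_z mu z z' : box z mu -> box z' mu -> F (pt2 z mu) = 0 ->
    F (pt2 z' mu) = 0 -> z = z'.
  move=> b b' Fz Fz'; have [xi [/Heta[_ mxi _] _]] := key _ _ _ _ b b'.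
  rewrite Fz Fz' !subrr mul0r addr0 => /esym/eqP; rewrite mulf_eq0.
  move=> /orP[|/eqP x0]; first by rewrite subr_eq0 => /eqP.
  by move: mxi; rewrite x0 leNgt m0.
have box0 : box z0 0 by split; rewrite ?subrr normr0.
have /choice[q Hq] : forall mu, exists z, `|mu| < r ->
    `|z - z0| <= h /\ F (pt2 z mu) = 0.
  move=> mu; have [mur|] := ltP `|mu| r; last by exists 0.
  have mueta : `|mu| < eta by apply: lt_trans heta; exact: lt_le_trans rh.
  have bnd z : `|z - z0| <= h -> box z mu by move=> zh; split => //; exact: le_lt_trans heta.
  have bp : box (z0 + h) mu by apply: bnd; rewrite addrC addrA addNr add0r gtr0_norm.
  have bm : box (z0 - h) mu by apply: bnd; rewrite addrC addrA addNr add0r normrN gtr0_norm.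
  have muM xi : B xi -> `|mu * partial 1 F xi| < h * m.
    move=> /Heta[_ _ Mxi]; apply: le_lt_trans rM.
    by rewrite normrM ler_pM// ltW.
  have Fp : 0 < F (pt2 (z0 + h) mu).
    have [xi [Bxi _]] := key _ _ _ _ box0 bp.
    rewrite F0 !subr0 => ->; have [_ mxi _] := Heta _ Bxi.
    have := muM _ Bxi; rewrite ltr_norml => /andP[+ _].
    have : h * m <= h * partial 0 F xi by rewrite ler_pM2l.
    rewrite (_ : z0 + h - z0 = h); last by ring.
    set a := mu * _; lra.
  have Fm : F (pt2 (z0 - h) mu) < 0.
    have [xi [Bxi _]] := key _ _ _ _ box0 bm.
    rewrite F0 !subr0 => ->; have [_ mxi _] := Heta _ Bxi.
    have := muM _ Bxi; rewrite ltr_norml => /andP[_ +].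
    have : h * m <= h * partial 0 F xi by rewrite ler_pM2l.
    rewrite (_ : z0 - h - z0 = - h); last by ring.
    set a := mu * _; lra.
  have inh z : z \in `[z0 - h, z0 + h] -> `|z - z0| <= h.
    by rewrite in_itv/= ler_norml => /andP[? ?]; apply/andP; split; lra.
  have [|||z zh Fz] := @IVT R (fun z => F (pt2 z mu)) (z0 - h) (z0 + h) 0.
  - lra.
  - apply/continuous_in_subspaceT => z /set_mem /inh /bnd /Bbox Bz.
    apply: (@continuous_comp _ _ _ (fun z => pt2 z mu) F); last first.
      exact: (C_order_continuous Bz (CFB 0)).
    apply: cvg_rV => i; rewrite !mxE.
    under eq_cvg do rewrite mxE.
    by case: ifPn => _; [exact: cvg_id|exact: cvg_cst].
  - by rewrite ge_min le_max (ltW Fm) (ltW Fp) orbT.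
  by exists z => _; split => //; exact: inh.
have qbox mu : `|mu| < r -> box (q mu) mu.
  move=> mur; have [qh _] := Hq _ mur; split; first exact: le_lt_trans heta.
  by apply: lt_trans heta; exact: lt_le_trans rh.
have q0 : q 0 = z0.
  have r00 : `|0 : R| < r by rewrite normr0.
  by apply: (uniq_z 0) => //; [exact: qbox|exact: (Hq _ r00).2].
have lip mu mu' : `|mu| < r -> `|mu'| < r ->
    `|q mu' - q mu| <= M / m * `|mu' - mu|.
  move=> b b'; have [xi [/Heta[_ mxi Mxi] _]] := key _ _ _ _ (qbox _ b) (qbox _ b').
  move: (partial 0 F xi) (partial 1 F xi) mxi Mxi => dz dm mxi Mxi.
  rewrite (Hq _ b).2 (Hq _ b').2 subrr => /esym/eqP; rewrite addr_eq0 => /eqP E.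
  have := congr1 Num.norm E; rewrite normrN !normrM => {}E.
  rewrite -mulrA mulrCA ler_pdivlMl// mulrC.
  apply: le_trans (_ : `|q mu' - q mu| * `|dz| <= _).
    by rewrite ler_wpM2l// (le_trans mxi)// ler_norm.
  by rewrite E mulrC ler_wpM2r.
pose D := [set x : R | `|x| < r].
have oD : open D by exact: open_disk.
have cq mu : D mu -> {for mu, continuous q}.
  move=> Dmu; apply/cvgrPdist_le => e e0.
  have MM0 : 0 < M / m by exact: divr_gt0.
  near=> mu'.
  apply: le_trans (lip _ _ _ Dmu) _; first by near: mu'; exact: (open_nbhs_nbhs (conj oD Dmu)).
  rewrite mulrC -ler_pdivlMr//; near: mu'.
  by apply: cvgr_dist_le; [exact: cvg_id|exact: divr_gt0].
(* The slope -F_mu / F_z of the zero set. Once q' = G(q, mu) is known, each order of regularity of q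
   yields the next. *)
pose G y := -1 * (partial 1 F y * (partial 0 F y)^-1).
have CG n : C_order n B G.
  apply: C_orderM => //; first exact: C_order_cst.
  apply: C_orderM => //; first exact: C_order_derive (CFB n.+1).
  apply: C_orderV => //; last exact: C_order_derive (CFB n.+1).
  by move=> y /Heta[_ my _]; rewrite gt_eqF// (lt_le_trans m0).
have cpt mu : D mu -> {for mu, continuous (fun mu => pt2 (q mu) mu)}.
  move=> Dmu; apply: cvg_rV => i; rewrite !mxE.
  under eq_cvg do rewrite mxE.
  by case: ifPn => _; [exact: cq|exact: cvg_id].
have dq mu : D mu -> is_derive mu 1 q (G (pt2 (q mu) mu)).
  move=> Dmu; have Bmu := Bbox _ _ (qbox _ Dmu).
  have /choice[xi Hxi] : forall h, exists xi,
      `|xi - pt2 (q mu) mu| <= `|pt2 (q (h + mu)) (h + mu) - pt2 (q mu) mu| /\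
      (D (h + mu) -> h != 0 -> h^-1 * (q (h + mu) - q mu) = G xi).
    move=> s; have [Ds|nDs] := pselect (D (s + mu)); last first.
      by exists (pt2 (q mu) mu); rewrite subrr normr0.
    have [xi [Bxi nxi]] := key _ _ _ _ (qbox _ Dmu) (qbox _ Ds).
    rewrite (Hq _ Dmu).2 (Hq _ Ds).2 subrr addrK => E.
    exists xi; split => // _ s0; rewrite /G.
    have [_ mxi _] := Heta _ Bxi.
    have p0 : partial 0 F xi != 0 by rewrite gt_eqF// (lt_le_trans m0).
    apply: (mulfI s0); rewrite mulVKf//; apply: (mulIf p0).
    rewrite -!mulrA mulVf// mulr1; apply/eqP; rewrite -subr_eq0; apply/eqP.
    by rewrite [RHS]E; ring.
  have c0' : s + mu @[s --> (0 : R)] --> mu.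
    rewrite -[X in _ --> X]add0r.
    by apply: cvgD; [exact: cvg_id|exact: cvg_cst].
  have cl : pt2 (q (s + mu)) (s + mu) @[s --> (0 : R)] --> pt2 (q mu) mu.
    exact: (cvg_comp _ _ c0' (cpt _ Dmu)).
  have cxi : xi s @[s --> (0 : R)] --> pt2 (q mu) mu.
    apply/cvgrPdist_lt => e e0.
    have H := (cvgrPdist_lt _ _).1 cl _ e0.
    near=> s; rewrite distrC; apply: le_lt_trans (Hxi s).1 _.
    by rewrite distrC; near: s; exact: H.
  have cGxi : G (xi s) @[s --> (0 : R)] --> G (pt2 (q mu) mu).
    exact: (cvg_comp _ _ cxi (C_order_continuous Bmu (CG 0))).
  have ca : s^-1 *: ((q \o shift mu) (s *: 1) - q mu) @[s --> 0^'] --> G (pt2 (q mu) mu).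
    apply: (@cvg_trans _ (G (xi s) @[s --> 0^'])); last first.
      by move=> A cA; apply: nbhs_dnbhs; exact: cGxi.
    apply: near_eq_cvg; near=> s.
    rewrite /= [s *: 1]mulr1 [RHS](_ : _ = s^-1 * (q (s + mu) - q mu))//.
    rewrite (Hxi s).2//.
      near: s; apply: nbhs_dnbhs; apply: c0'; exact: (open_nbhs_nbhs (conj oD Dmu)).
    by near: s; exact: nbhs_dnbhs_neq.
  split; last exact: cvg_lim.
  by apply/cvg_ex; eexists; exact: ca.
exists q, r; split => //.
- elim=> [|n IH]; first by split.
  apply: (@C_orderI _ _ _ _ _ (fun v mu : R => v * G (pt2 (q mu) mu))) => //.
    move=> mu v Dmu; have [d E] := dq _ Dmu.
    by have := is_deriveZv v d; rewrite E /GRing.scale/= mulr1.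
  move=> v; apply: C_orderM => //; first exact: C_order_cst.
  apply: (C_order_comp oD oB) => //; first by move=> mu /qbox/Bbox.
  by move=> i; exact: C_order_pt2.
- by move=> mu mur; split; [exact/BU/Bbox/qbox|exact: (Hq _ mur).2].
- move=> mu z mur zr Fz; apply: (uniq_z mu) => //; [|exact: qbox|exact: (Hq _ mur).2].
  split; [|by apply: lt_trans heta; exact: lt_le_trans rh].
  by apply: lt_trans heta; exact: lt_le_trans rh.
Unshelve. all: by end_near. Qed.

(** Multiplying F by its own z-derivative c at the point keeps the zeros and turns that derivative
    into c^2 > 0. *)
Lemma implicit_function (F : 'rV[R]_2 -> R) (U : set 'rV[R]_2) (z0 : R) :
  open U -> U (pt2 z0 0) -> (forall n, C_order n U F) -> F (pt2 z0 0) = 0 ->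
  partial 0 F (pt2 z0 0) != 0 ->
  exists (q : R -> R) (r : R), [/\ 0 < r, q 0 = z0,
    forall n, C_order n [set x : R | `|x| < r] q,
    forall mu, `|mu| < r -> U (pt2 (q mu) mu) /\ F (pt2 (q mu) mu) = 0 &
    forall mu z, `|mu| < r -> `|z - z0| < r -> F (pt2 z mu) = 0 -> z = q mu].
Proof.
move=> oU U0 CF F0; set c := partial 0 F _ => c0.
have dF := derivableP (C_order_derivable (v := delta_mx 0 0) U0 (CF 1)).
have [_ E] := is_deriveM (is_derive_cst c (pt2 z0 0) (delta_mx 0 0)) dF.
have [|||q [r [r0 q0 Cq Hq uq]]] := @implicit_function_pos (fun x => c * F x) U z0 oU U0.
- by move=> n; apply: C_orderM => //; exact: C_order_cst.
- by rewrite F0 mulr0.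
- rewrite /partial [ltRHS]E scaler0 addr0 /GRing.scale/= -/(partial 0 F _) -/c.
  by rewrite -expr2 exprn_even_gt0//= c0 orbT.
exists q, r; split => //.
  by move=> mu /Hq[? /eqP]; rewrite mulf_eq0 (negbTE c0) => /eqP.
by move=> mu z mur zr Fz; apply: uq => //; rewrite Fz mulr0.
Qed.

End ImplicitFunction.

(** * Blow-up of one equation at the origin *)

Section BlowUp.
Variables (R : realType) (m : nat) (f : 'rV[R]_m -> R) (i0 : 'I_m).
Variables (a : R -> 'rV[R]_m) (c : R -> R) (r0 z0 A B C : R).

Let w (z mu : R) : 'rV[R]_m := z *: delta_mx 0 i0 + a mu.

(* [f (mu *: w z mu) / mu ^+ 2] extends smoothly to [mu = 0], where it is
   [A z^2 + B z + C]; the implicit function theorem applies at the simple root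
   [z0]. *)
Lemma blow_up : (forall n, C_order n setT f) -> f 0 = 0 -> d1 f i0 = 0 -> 0 < r0 ->
  (forall i n, C_order n [set x : R | `|x| < r0] (fun mu => a mu 0 i)) ->
  (forall n, C_order n [set x : R | `|x| < r0] c) ->
  (forall mu, `|mu| < r0 -> \sum_i a mu 0 i * d1 f i = mu * c mu) ->
  (forall z, c 0 + 2^-1 * \sum_i \sum_j w z 0 0 i * w z 0 0 j * d2 f i j =
     A * z ^+ 2 + B * z + C) ->
  A * z0 ^+ 2 + B * z0 + C = 0 -> 2 * A * z0 + B != 0 ->
  exists (q : R -> R) (r : R), [/\ 0 < r, q 0 = z0,
    forall n, C_order n [set x : R | `|x| < r] q,
    forall mu, `|mu| < r -> f (mu *: w (q mu) mu) = 0 &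
    forall mu z, mu != 0 -> `|mu| < r -> `|z - z0| < r -> f (mu *: w z mu) = 0 ->
      z = q mu].
Proof.
move=> Cf f0 df0 r00 Ca Cc lin quad root simple.
pose wx (x : 'rV[R]_2) := w (x 0 0) (x 0 1).
(* The quotient by mu^2. The linear part gives [c], since its z term vanishes with [d1 f i0]; in the
   quadratic part mu^2 factors out, the coefficients being evaluated at mu w and thus smooth across
   mu = 0. *)
pose F (x : 'rV[R]_2) := c (x 0 1) +
  \sum_i \sum_j wx x 0 i * wx x 0 j * quad_coef f i j (x 0 1 *: wx x).
pose U := [set x : 'rV[R]_2 | `|x 0 1| < r0].
have oU : open U.
  apply: (@open_comp _ _ (fun x : 'rV[R]_2 => x 0 1) [set x : R | `|x| < r0]).
    by move=> x _; exact: coord_continuous.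
  exact: open_disk.
have Cmu n : C_order n U (fun x : 'rV[R]_2 => x 0 1) by exact: C_order_coord.
have Cw n i : C_order n U (fun x => wx x 0 i).
  rewrite (_ : (fun x => _) = fun x : 'rV[R]_2 =>
      x 0 0 * (delta_mx 0 i0 : 'rV[R]_m) 0 i + a (x 0 1) 0 i); last first.
    by apply/funext => x; rewrite !mxE.
  apply: C_orderD => //.
    by apply: C_orderM => //; [exact: C_order_coord|exact: C_order_cst].
  exact: (C_order_comp1 oU (open_disk (r:=r0)) (fun x Ux => Ux) (Cmu n) (Ca i n)).
have CF n : C_order n U F.
  apply: C_orderD => //.
    exact: (C_order_comp1 oU (open_disk (r:=r0)) (fun x Ux => Ux) (Cmu n) (Cc n)).
  apply: C_order_sum => // i _; apply: C_order_sum => // j _.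
  apply: C_orderM => //; first by apply: C_orderM => //; exact: Cw.
  apply: (C_order_comp oU openT) => //; last exact: C_order_quad_coef.
  move=> k; rewrite (_ : (fun x => _) = fun x : 'rV[R]_2 => x 0 1 * wx x 0 k); last first.
    by apply/funext => x; rewrite mxE.
  by apply: C_orderM => //; exact: Cw.
have FE z mu : `|mu| < r0 -> f (mu *: w z mu) = mu ^+ 2 * F (pt2 z mu).
  move=> mur; rewrite taylor_quad// /F /wx pt2_0 pt2_1 mulrDr; congr (_ + _).
    rewrite expr2 -mulrA -lin// mulr_sumr.
    transitivity (\sum_i (mu * z * ((i == i0)%:R * d1 f i) + mu * (a mu 0 i * d1 f i))).
      by apply: eq_bigr => i _; rewrite !mxE/=; ring.
    by rewrite big_split/= -mulr_sumr sum_deltaM df0 mulr0 add0r.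
  rewrite mulr_sumr; apply: eq_bigr => i _; rewrite mulr_sumr; apply: eq_bigr => j _.
  rewrite ![(mu *: w z mu) 0 _]mxE; move: (quad_coef _ _ _ _) (w z mu 0 _) (w z mu 0 _).
  by move=> q1 q2 q3; ring.
have F0 z : F (pt2 z 0) = A * z ^+ 2 + B * z + C.
  rewrite /F /wx pt2_0 pt2_1 -quad; congr (_ + _).
  rewrite mulr_sumr; apply: eq_bigr => i _; rewrite mulr_sumr; apply: eq_bigr => j _.
  by rewrite scale0r quad_coef0// mulrCA.
have dF : partial 0 F (pt2 z0 0) = 2 * A * z0 + B.
  apply: cvg_lim => //.
  have ch : A * h + (2 * A * z0 + B) @[h --> (0 : R)] --> A * 0 + (2 * A * z0 + B).
    by apply: cvgD; [apply: cvgMl_tmp; exact: cvg_id|exact: cvg_cst].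
  rewrite mulr0 add0r in ch.
  apply: (@cvg_trans _ (A * h + (2 * A * z0 + B) @[h --> (0 : R)^'])); last first.
    by move=> S cS; apply: nbhs_dnbhs; exact: ch.
  apply: near_eq_cvg; near=> h.
  have h0 : h != 0 by near: h; exact: nbhs_dnbhs_neq.
  have -> : (F \o shift (pt2 z0 0)) (h *: delta_mx 0 0) = F (pt2 (h + z0) 0).
    rewrite /=; congr F; apply/rowP => i; rewrite !mxE/=.
    by case: (i == 0); rewrite ?mulr1 ?mulr0 ?add0r ?addr0.
  by rewrite !F0 /GRing.scale/=; field.
have U0 : U (pt2 z0 0) by rewrite /U/= pt2_1 normr0.
have [||q [r [r1 q0 Cq Hq uq]]] := implicit_function oU U0 CF.
- by rewrite F0.
- by rewrite dF.
exists q, (Num.min r r0); split => //.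
- by rewrite lt_min r1.
- by move=> n; apply: C_order_sub (Cq n) => x /=; rewrite lt_min => /andP[].
- move=> mu; rewrite lt_min => /andP[mur mur0].
  by rewrite FE// (Hq _ mur).2 mulr0.
- move=> mu z mu0; rewrite !lt_min => /andP[mur mur0] /andP[zr _].
  rewrite FE// => /eqP; rewrite mulf_eq0 expf_eq0/= (negbTE mu0) => /eqP.
  exact: uq.
Unshelve. all: by end_near. Qed.

End BlowUp.

(** * Construction of the cell profiles *)

Section Vars.
Variables (R : realType) (k : nat).
Implicit Types (f : 'rV[R]_(1 + k + 1) -> R) (x : 'I_k -> R).

Lemma vars_ix0 (x0 : R) x lam : vars x0 x lam 0 (ix0 k) = x0.
Proof. by rewrite /vars /ix0 !row_mxEl mxE eqxx mulr1n. Qed.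

Lemma vars_ix (x0 : R) x lam i : vars x0 x lam 0 (ix i) = x i.
Proof. by rewrite /vars /ix row_mxEl row_mxEr mxE. Qed.

Lemma vars_ilam (x0 : R) x lam : vars x0 x lam 0 (ilam k) = lam.
Proof. by rewrite /vars /ilam row_mxEr mxE eqxx mulr1n. Qed.

Lemma sum_vars (F : 'I_(1 + k + 1) -> R) :
  \sum_j F j = F (ix0 k) + \sum_i F (ix i) + F (ilam k).
Proof. by rewrite big_split_ord/= big_ord1 big_split_ord/= big_ord1. Qed.

Lemma vars_ind (P : 'I_(1 + k + 1) -> Prop) :
  P (ix0 k) -> (forall i, P (ix i)) -> P (ilam k) -> forall j, P j.
Proof.
move=> h0 hi hl j; case: (split_ordP j) => j1 ->; last by rewrite (ord1 j1).
by case: (split_ordP j1) => j2 ->; [rewrite (ord1 j2)|exact: hi].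
Qed.

Lemma vars_ext (u v : 'rV[R]_(1 + k + 1)) : u 0 (ix0 k) = v 0 (ix0 k) ->
  (forall i, u 0 (ix i) = v 0 (ix i)) -> u 0 (ilam k) = v 0 (ilam k) -> u = v.
Proof. by move=> h0 hi hl; apply/rowP; exact: vars_ind. Qed.

Lemma quad_form_vars (v : 'rV[R]_(1 + k + 1)) (M : 'I_(1 + k + 1) -> 'I_(1 + k + 1) -> R) :
  (forall i, v 0 (ix i) = 0) ->
  \sum_i \sum_j v 0 i * v 0 j * M i j =
  v 0 (ix0 k) ^+ 2 * M (ix0 k) (ix0 k) +
  v 0 (ix0 k) * v 0 (ilam k) * (M (ix0 k) (ilam k) + M (ilam k) (ix0 k)) +
  v 0 (ilam k) ^+ 2 * M (ilam k) (ilam k).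
Proof.
move=> vi.
have E i : \sum_j v 0 i * v 0 j * M i j =
    v 0 i * (v 0 (ix0 k) * M i (ix0 k) + v 0 (ilam k) * M i (ilam k)).
  rewrite sum_vars big1 => [|j _]; last by rewrite vi mulr0 mul0r.
  by rewrite addr0 mulrDr !mulrA.
under eq_bigr do rewrite E.
rewrite sum_vars big1 => [|j _]; last by rewrite vi mul0r.
ring.
Qed.

Lemma ix_neq0 (i : 'I_k) : (ix i == ix0 k) = false.
Proof. by apply/negP => /eqP/lshift_inj/eqP; rewrite eq_rlshift. Qed.

Lemma ilam_neq0 : (ilam k == ix0 k) = false.
Proof. by rewrite eq_rlshift. Qed.

Lemma ix_neq_ilam (i : 'I_k) : (ix i == ilam k) = false.
Proof. by rewrite eq_lrshift. Qed.

Lemma delta_addE m (z : R) (v : 'rV[R]_m) (i j : 'I_m) :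
  (z *: delta_mx 0 i + v) 0 j = z * (j == i)%:R + v 0 j.
Proof. by rewrite !mxE eqxx. Qed.

Lemma scale_vars (a x0 lam : R) x :
  a *: vars x0 x lam = vars (a * x0) (fun i => a * x i) (a * lam).
Proof.
by apply: vars_ext => [|i|]; rewrite mxE ?vars_ix0 ?vars_ix ?vars_ilam.
Qed.

Lemma add_vars0 (z lam : R) x :
  z *: delta_mx 0 (ix0 k) + vars 0 x lam = vars z x lam.
Proof.
apply: vars_ext => [|i|]; rewrite delta_addE ?vars_ix0 ?vars_ix ?vars_ilam.
- by rewrite eqxx mulr1 addr0.
- by rewrite ix_neq0 mulr0 add0r.
- by rewrite ilam_neq0 mulr0 add0r.
Qed.

Lemma vars0 : vars 0 (fun=> 0) 0 = 0 :> 'rV[R]_(1 + k + 1).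
Proof. by apply: vars_ext => [|i|]; rewrite ?vars_ix0 ?vars_ix ?vars_ilam mxE. Qed.

(** The conclusion has the shape of the hypothesis, so it can be iterated: once for f_lam, twice for
    f_lamlam. *)
Lemma partial_lam0 f : (forall lam, f (vars 0 (fun=> 0) lam) = 0) ->
  forall lam, partial (ilam k) f (vars 0 (fun=> 0) lam) = 0.
Proof.
move=> f0 lam; apply: cvg_lim => //.
rewrite (_ : (fun h => _) = cst 0); first exact: cvg_cst.
apply/funext => h /=; rewrite f0 (_ : _ + _ = vars 0 (fun=> 0) (h + lam)).
  by rewrite f0 subrr scaler0.
apply: vars_ext => [|i|]; rewrite delta_addE ?vars_ix0 ?vars_ix ?vars_ilam ?addr0.
- by rewrite eq_sym ilam_neq0 mulr0.
- by rewrite ix_neq_ilam mulr0.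
- by rewrite eqxx mulr1.
Qed.

Lemma calV_C_order f n : calV f -> C_order n setT f.
Proof. by move=> [/(smooth_on_C_order _ openT)]. Qed.

Lemma calV_at0 f : calV f -> f 0 = 0.
Proof. by move=> [_ f0]; rewrite -vars0. Qed.

Lemma d1_ilam f : calV f -> d1 f (ilam k) = 0.
Proof. by move=> [_ f0]; rewrite /d1 -vars0 partial_lam0. Qed.

Lemma d2_ilam f : calV f -> d2 f (ilam k) (ilam k) = 0.
Proof. by move=> [_ f0]; rewrite /d2 -vars0; apply/partial_lam0/partial_lam0. Qed.

End Vars.

Section Cells.

Local Opaque d1 d2.

Variables (R : realType) (k : nat) (N : network k) (f : 'rV[R]_(1 + k + 1) -> R).
Variables (delta : int) (p : cell N -> int) (s : cell N -> R).

(* The side of 0 on which the branch lives; two-sided branches are parametrized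
   by [lam] itself. *)
Definition side : R := if delta == -1 then -1 else 1.

(** The number of squarings from the parameter of c to that of its source. For a source of order -1
    it is n + 1, a harmless value since the profile of that source is zero. *)
Definition gap (n : nat) (c : cell N) (i : 'I_k) : nat := `|n%:Z - p (src i c)|%N.

(* With [mu = |lam|^(2^-n)], the cell [d] of order [n - m] has the value
   [mu^(2^m) * q d (mu^(2^m))]. *)
Definition cell_arg (q : cell N -> R -> R) (c : cell N) (n : nat) (mu z : R) :=
  vars (mu * z)
    (fun i => mu ^+ (2 ^ gap n c i) * q (src i c) (mu ^+ (2 ^ gap n c i)))
    (side * mu ^+ (2 ^ n)).

(** [q c] stands for b_c divided by its parameter mu, as a function of mu. Slopes are taken with
    respect to lam, hence the factor [side] at mu = 0. The last clause records local uniqueness for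
    later use; it excludes mu = 0, where the equation holds for every z. *)
Definition profile_at (q : cell N -> R -> R) (r : R) (c : cell N) : Prop :=
  [/\ forall n, C_order n [set x : R | `|x| < r] (q c),
      side * q c 0 = s c,
      p c = -1 -> forall x, q c x = 0 &
      forall n : nat, p c = n%:Z ->
        (forall mu, `|mu| < r -> f (cell_arg q c n mu (q c mu)) = 0) /\
        (forall mu z, mu != 0 -> `|mu| < r -> `|z - q c 0| < r ->
           f (cell_arg q c n mu z) = 0 -> z = q c mu)].

Lemma profile_at_le q r r' c : r' <= r -> profile_at q r c -> profile_at q r' c.
Proof.
move=> r'r [Cq q0 qm1 qn]; split => //.
  by move=> n; apply: C_order_sub (Cq n) => x /= /lt_le_trans; apply.
move=> n /qn[h1 h2]; split => [mu mur|mu z mu0 mur zr].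
  by apply: h1; exact: lt_le_trans r'r.
by apply: h2 => //; exact: lt_le_trans r'r.
Qed.

Hypotheses (fV : calV0 f) (f00 : d2 f (ix0 k) (ix0 k) != 0)
  (f0l : d2 f (ix0 k) (ilam k) != 0).
Hypotheses (hO : Omega f delta p s) (pge : forall c, -1 <= p c).

Lemma side2 : side * side = 1.
Proof. by rewrite /side; case: ifP => _; rewrite ?mulrNN mulr1. Qed.

Lemma side_neq0 : side != 0.
Proof. by rewrite /side; case: ifP => _; rewrite ?oppr_eq0 oner_eq0. Qed.

Lemma sideE : delta != 0 -> delta%:~R = side.
Proof.
case: hO => + _ _; rewrite /side !inE => /or3P[] /eqP -> //= _.
Qed.

Lemma gap_gt0 n c i : p c = n%:Z -> (0 < gap n c i)%N.
Proof.
move=> pc; case: hO => _ _ /(_ c) [_ + _ _ _]; rewrite pc => /(_ _)[//|/(_ i) h _].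
by rewrite /gap; move: (p _) h => x; lia.
Qed.

Lemma expr0_pow2_sub1 n : (0 : R) ^+ (2 ^ n - 1) = (n == 0%N)%:R.
Proof.
by case: n => [|n]; rewrite ?subnn// expr0n subn_eq0 leqNgt -{1}(expn0 2) ltn_exp2l.
Qed.

Lemma expr0_pow2_sub2 n : (0 < n)%N -> (0 : R) ^+ (2 ^ n - 2) = (n == 1%N)%:R.
Proof.
case: n => [//|[|n]] _; rewrite ?subnn// expr0n subn_eq0 leqNgt.
by rewrite -{1}(expn1 2) ltn_exp2l.
Qed.

(** With the sources already solved, the equation of c has one unknown z and one parameter mu, and
    [blow_up] applies at z = side * s c. *)
Lemma solve_cell (q : cell N -> R -> R) (r : R) c n : 0 < r <= 1 ->
  p c = n%:Z -> (forall i, profile_at q r (src i c)) ->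
  exists (qc : R -> R) (rc : R), [/\ 0 < rc,
    forall n, C_order n [set x : R | `|x| < rc] qc,
    side * qc 0 = s c,
    forall mu, `|mu| < rc -> f (cell_arg q c n mu (qc mu)) = 0 &
    forall mu z, mu != 0 -> `|mu| < rc -> `|z - qc 0| < rc ->
      f (cell_arg q c n mu z) = 0 -> z = qc mu].
Proof.
move=> /andP[r0 r1] pc Hq.
pose D := [set x : R | `|x| < r].
have oD : open D by exact: open_disk.
have gp i : (0 < gap n c i)%N by exact: gap_gt0.
have Cu i j : C_order j D (fun mu => q (src i c) (mu ^+ (2 ^ gap n c i))).
  have [Cqi _ _ _] := Hq i.
  apply: (@C_order_comp1 _ _ j D D (q (src i c)) (fun mu : R => mu ^+ (2 ^ gap n c i))) => //.
    (* Powers of mu stay in the disk because r <= 1. *)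
    move=> x Dx; rewrite /D/= normrX; apply: le_lt_trans (Dx).
    rewrite -[leRHS]expr1 ler_wiXn2l// ?expn_gt0//.
    exact/ltW/(lt_le_trans Dx).
  by apply: C_orderX => //; exact: C_order_id.
have CX e j : C_order j D (fun mu : R => mu ^+ e).
  by apply: C_orderX => //; exact: C_order_id.
(* One factor mu is taken out of every argument, and in [cc] a second one out of the linear part.
   The natural subtractions do not truncate: gaps are positive, so 2^gap >= 2, and 2^n >= 1. *)
pose a mu := vars 0 (fun i => mu ^+ (2 ^ gap n c i - 1) *
  q (src i c) (mu ^+ (2 ^ gap n c i))) (side * mu ^+ (2 ^ n - 1)).
pose cc mu := \sum_i d1 f (ix i) * (mu ^+ (2 ^ gap n c i - 2) *
  q (src i c) (mu ^+ (2 ^ gap n c i))).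
have argE mu z : cell_arg q c n mu z = mu *: (z *: delta_mx 0 (ix0 k) + a mu).
  rewrite add_vars0 scale_vars /cell_arg; congr vars.
    apply/funext => i; rewrite mulrA -exprS; congr (_ ^+ _ * _).
    by rewrite subn1 prednK// expn_gt0.
  by rewrite mulrCA -exprS subn1 prednK// expn_gt0.
have [fC f0] := fV.
have [_ dle /(_ c)[_ Hp Hs Hs0 Hsp]] := hO.
have [psrc _] : (forall i, p (src i c) <= p c - 1) /\ exists i, p (src i c) = p c - 1.
  by apply: Hp; rewrite pc.
have sc0 : s c != 0 by apply/eqP => /Hs; rewrite pc.
(* At mu = 0 the power mu^(2^gap - 2) survives only for gap 1, which singles out the index set of
   [radicand]. *)
have cc0 : cc 0 = \sum_(i < k | p (src i c) == p c - 1) d1 f (ix i) * (side * s (src i c)).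
  rewrite [RHS]big_mkcond; apply: eq_bigr => i _; rewrite expr0_pow2_sub2//.
  have [_ <- _ _] := Hq i.
  have -> : (gap n c i == 1%N) = (p (src i c) == p c - 1).
    by have := psrc i; rewrite /gap pc; move: (p _) => x; lia.
  case: ifP => _; last by rewrite mul0r mulr0.
  by rewrite mul1r [side * (side * _)]mulrA side2 mul1r expr0n expn_eq0.
(* lam / mu is side * mu^(2^n - 1), so the mixed term with lam survives at mu = 0 only for n = 0. *)
pose B := if n == 0%N then side * d2 f (ix0 k) (ilam k) else 0.
have Ca j e : C_order e D (fun mu => a mu 0 j).
  move: j; apply: vars_ind => [|i|].
  - rewrite (_ : (fun mu => _) = cst 0); first exact: C_order_cst.
    by apply/funext => mu; rewrite vars_ix0.
  - rewrite (_ : (fun mu => _) = fun mu => mu ^+ (2 ^ gap n c i - 1) *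
      q (src i c) (mu ^+ (2 ^ gap n c i))); first exact: C_orderM.
    by apply/funext => mu; rewrite vars_ix.
  - rewrite (_ : (fun mu => _) = fun mu => side * mu ^+ (2 ^ n - 1)).
      by apply: C_orderM => //; exact: C_order_cst.
    by apply/funext => mu; rewrite vars_ilam.
have Cc e : C_order e D cc.
  apply: C_order_sum => // i _; apply: C_orderM => //; first exact: C_order_cst.
  exact: C_orderM.
have lin mu : `|mu| < r -> \sum_j a mu 0 j * d1 f j = mu * cc mu.
  move=> _; rewrite sum_vars vars_ix0 vars_ilam mul0r add0r d1_ilam// mulr0 addr0.
  rewrite mulr_sumr; apply: eq_bigr => i _; rewrite vars_ix.
  have -> : (2 ^ gap n c i - 1 = (2 ^ gap n c i - 2).+1)%N.
    by rewrite -subSn// -[X in (X <= _)%N]expn1 leq_exp2l.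
  by rewrite exprS; ring.
have quad z : cc 0 + 2^-1 * \sum_i \sum_j
    (z *: delta_mx 0 (ix0 k) + a 0) 0 i * (z *: delta_mx 0 (ix0 k) + a 0) 0 j * d2 f i j =
    2^-1 * d2 f (ix0 k) (ix0 k) * z ^+ 2 + B * z + cc 0.
  rewrite add_vars0.
  have v0 i : vars z (fun i => 0 ^+ (2 ^ gap n c i - 1) *
      q (src i c) (0 ^+ (2 ^ gap n c i))) (side * 0 ^+ (2 ^ n - 1)) 0 (ix i) = 0.
    by rewrite vars_ix expr0_pow2_sub1 gtn_eqF ?gp// mul0r.
  rewrite quad_form_vars// vars_ix0 vars_ilam (d2_ilam fC).
  rewrite (d2_sym (ilam k) (ix0 k) (fun j => calV_C_order j fC)) expr0_pow2_sub1 /B.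
  move: (d2 f _ _) (d2 f _ _) (cc 0) => x y w.
  by case: (n == 0%N) => /=; field.
have sc00 : n = 0%N -> d2 f (ix0 k) (ix0 k) * s c = - (2 * d2 f (ix0 k) (ilam k)).
  move=> n0; have pc0 : p c = 0 by rewrite pc n0.
  by rewrite (Hs0 pc0) [LHS]mulrC (divfK f00).
(* For n = 0 the sources have slope 0, so the constant term vanishes and f_00 s_c = -2 f_0lam. For n
   > 0 the equation says that s_c^2 is the radicand, delta being equal to [side]. *)
have root : 2^-1 * d2 f (ix0 k) (ix0 k) * (side * s c) ^+ 2 + B * (side * s c) + cc 0 = 0.
  rewrite exprMn [side ^+ 2]expr2 side2 mul1r /B; case: eqVneq => [n0|n0].
    have -> : cc 0 = 0.
      rewrite cc0 big1// => i /eqP pi; have [_ _ /(_ (src i c))[_ _ [+ _] _ _]] := hO.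
      by rewrite pi pc n0 => ->//; rewrite !mulr0.
    move: (d2 f (ix0 k) (ix0 k)) (d2 f (ix0 k) (ilam k)) (s c) side (sc00 n0) side2 => x y t e E E2.
    rewrite addr0 (_ : _ + _ = 2^-1 * t * (x * t) + y * t * (e * e)); last by ring.
    by rewrite E E2; field.
  have dn0 : delta != 0.
    by apply/eqP => /dle/(_ c); rewrite pc; move: n0; case: (n).
  have [] := Hsp; first by rewrite pc ltz_nat lt0n.
  move=> rad0 sE; have -> : s c ^+ 2 = radicand f delta p s c.
    by case: sE => ->; rewrite ?sqrrN sqr_sqrtr.
  rewrite /radicand sideE// mul0r addr0 cc0.
  have -> : \sum_(i < k | p (src i c) == p c - 1) d1 f (ix i) * (side * s (src i c)) =
     side * \sum_(i < k | p (src i c) == p c - 1) d1 f (ix i) * s (src i c).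
    by rewrite mulr_sumr; apply: eq_bigr => i _; rewrite mulrCA.
  move: (d2 f _ _) f00 (\sum_(i < k | _) _) side => x x0 y e.
  by field.
(* The value is -side * f_0lam for n = 0 and side * f_00 * s_c for n > 0. *)
have simple : 2 * (2^-1 * d2 f (ix0 k) (ix0 k)) * (side * s c) + B != 0.
  have E (x y t : R) : 2 * (2^-1 * x) * (y * t) = y * (x * t) by field.
  rewrite E /B; case: (eqVneq n 0%N) => [n0|n0]; last first.
    rewrite addr0; apply: mulf_neq0; first exact: side_neq0.
    exact: mulf_neq0 f00 sc0.
  rewrite sc00// -mulrDr; apply: mulf_neq0; first exact: side_neq0.
  by rewrite mulr_natl mulr2n opprD subrK oppr_eq0.
have [qc [rc [rc0 qc0 Cqc Hqc uqc]]] :=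
  blow_up (fun j => calV_C_order j fC) (calV_at0 fC) f0 r0 Ca Cc lin quad root simple.
exists qc, rc; split => //.
- by rewrite qc0 mulrA side2 mul1r.
- by move=> mu mur; rewrite argE Hqc.
- by move=> mu z mu0 mur; rewrite argE qc0; exact: uqc.
Qed.

Lemma cell_arg_ext q q' c n : (forall i, q' (src i c) = q (src i c)) ->
  cell_arg q' c n = cell_arg q c n.
Proof.
move=> qq'; rewrite /cell_arg; apply/funext => mu; apply/funext => z.
by congr vars; apply/funext => i; rewrite qq'.
Qed.

Lemma profile_at_ext q q' r c : q' c = q c ->
  (0 <= p c -> forall i, q' (src i c) = q (src i c)) ->
  profile_at q r c -> profile_at q' r c.
Proof.
move=> qc qs [Cq q0 qm1 qn]; split; rewrite ?qc//.
move=> n pc; have [h1 h2] := qn n pc.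
by rewrite (@cell_arg_ext q)//; apply: qs; rewrite pc.
Qed.

Lemma finite_radius (T : finType) (P : T -> R -> Prop) :
  (forall c r r', r' <= r -> P c r -> P c r') ->
  (forall c, exists2 r, 0 < r & P c r) -> exists2 r, 0 < r & forall c, P c r.
Proof.
move=> Ple /(_ _)/cid2-/all_sig[rad radP].
have rad0 c : 0 < rad c by have [] := radP c.
exists (\big[Num.min/1]_c rad c); first by apply: lt_bigmin.
move=> c; have [_ Pc] := radP c; apply: Ple Pc.
exact: bigmin_le_cond.
Qed.

Lemma src_lt c i : 0 <= p c -> p (src i c) <= p c - 1.
Proof.
move=> pc; have [_ _ /(_ c)[_ + _ _ _]] := hO.
by move=> /(_ (lt_le_trans _ pc))[].
Qed.

(** Induction on a strict bound n for the order; for n = 0 only cells of order -1 are concerned. All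
    cells of order n are solved at once. Changing their profiles does not disturb the equations
    already solved, whose sources have smaller order. *)
Lemma exists_profiles : exists (q : cell N -> R -> R) (r : R),
  0 < r <= 1 /\ forall c, profile_at q r c.
Proof.
have Hs c : p c = -1 <-> s c = 0 by have [_ _ /(_ c)[]] := hO.
suff H n : exists (q : cell N -> R -> R) (r : R),
    0 < r <= 1 /\ forall c, p c < n%:Z -> profile_at q r c.
  have [q [r [r01 Hq]]] := H (\max_c `|p c|%N).+1.
  exists q, r; split => // c; apply: Hq.
  have : (`|p c| <= \max_c `|p c|)%N by exact: (leq_bigmax c).
  by move: (\max_c _) => M; lia.
elim: n => [|n [q [r [/andP[r0 r1] Hq]]]].
  exists (fun _ _ => 0), 1; rewrite ltr01 lexx; split => // c pc.
  have pm1 : p c = -1 by have := pge c; lia.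
  split => //.
  - by move=> n; exact: C_order_cst.
  - by rewrite mulr0; apply/esym/Hs.
  - by move=> n; rewrite pm1.
have Hsrc c i : 0 <= p c -> p c <= n%:Z -> p (src i c) < n%:Z.
  by move=> pc pcn; have := src_lt i pc; lia.
(* A profile with its radius for each cell of order n; cells of other orders receive the dummy pair
   (0, 1). *)
have /choice[qr Hqr] : forall c, exists qr : (R -> R) * R, 0 < qr.2 /\
    (p c = n%:Z -> [/\ forall n, C_order n [set x : R | `|x| < qr.2] qr.1,
    side * qr.1 0 = s c,
    forall mu, `|mu| < qr.2 -> f (cell_arg q c n mu (qr.1 mu)) = 0 &
    forall mu z, mu != 0 -> `|mu| < qr.2 -> `|z - qr.1 0| < qr.2 ->
      f (cell_arg q c n mu z) = 0 -> z = qr.1 mu]).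
  move=> c; have [pc|/eqP npc] := eqVneq (p c) n%:Z; last first.
    by exists (fun=> 0, 1).
  have [||qc [rc [? ? ? ? ?]]] := @solve_cell q r c n _ pc; first by rewrite r0.
    by move=> i; apply/Hq/Hsrc; rewrite pc.
  by exists (qc, rc).
pose q' c := if p c == n%:Z then (qr c).1 else q c.
have q'src c i : 0 <= p c -> p c <= n%:Z -> q' (src i c) = q (src i c).
  by move=> p0 pn; rewrite /q'; have := Hsrc c i p0 pn; case: eqVneq => // ->; rewrite ltxx.
have [rr rr0 Hrr] : exists2 rr, 0 < rr & forall c, p c < n.+1%:Z -> profile_at q' rr c.
  apply: (@finite_radius _ (fun c rr => p c < n.+1%:Z -> profile_at q' rr c)).
    by move=> c r2 r3 r32 H /H; exact: profile_at_le.
  move=> c; have [pc|npc] := eqVneq (p c) n%:Z; last first.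
    exists r => // pcn; have {}pcn : p c < n%:Z by lia.
    apply: (@profile_at_ext q); last exact: Hq.
      by rewrite /q' (negbTE npc).
    by move=> p0 i; apply: q'src => //; exact: ltW.
  have [rc0 /(_ pc)[h1 h2 h3 h4]] := Hqr c.
  exists (qr c).2 => // _; split; rewrite /q' pc eqxx//.
  move=> n0 [<-]; rewrite (@cell_arg_ext q)//.
  by move=> i; apply: q'src; rewrite pc.
exists q', (Num.min rr 1); split.
  by rewrite lt_min rr0 ltr01/= ge_min lexx orbT.
by move=> c /Hrr; apply: profile_at_le; rewrite ge_min lexx.
Qed.

End Cells.

Local Transparent d1 d2.

(** * Square-root orders *)

Section Root2.
Variable R : realType.
Implicit Types (x y t : R) (n : nat).

Lemma root2_ge0 n x : 0 <= root2 n x.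
Proof. exact: powR_ge0. Qed.

Lemma root2_gt0 n x : x != 0 -> 0 < root2 n x.
Proof. by move=> x0; rewrite powR_gt0// normr_gt0. Qed.

Lemma root2_0 n : root2 n (0 : R) = 0.
Proof. by rewrite /root2 normr0 powR0// invr_neq0// expf_neq0// pnatr_eq0. Qed.

Lemma root2_abs n x : root2 n `|x| = root2 n x.
Proof. by rewrite /root2 normr_id. Qed.

Lemma root2_pow m n x : root2 (m + n) x ^+ (2 ^ m) = root2 n x.
Proof.
rewrite /root2 -powR_mulrn ?powR_ge0// -powRrM; congr (_ `^ _).
by rewrite natrX exprD invfM mulrAC mulVf ?mul1r.
Qed.

Lemma root2_0n x : root2 0 x = `|x|.
Proof. by rewrite /root2 expr0 invr1 powRr1. Qed.

Lemma root2K n x : root2 n x ^+ (2 ^ n) = `|x|.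
Proof. by rewrite -{1}(addn0 n) root2_pow root2_0n. Qed.

Lemma root2_lt n x (e : R) : 0 < e -> `|x| < e ^+ (2 ^ n) -> root2 n x < e.
Proof.
move=> e0; rewrite -(root2K n) ltr_pXn2r// ?nnegrE ?root2_ge0 ?ltW//.
by rewrite expn_gt0.
Qed.

Lemma root2_le n x (e : R) : 0 < e -> `|x| <= e ^+ (2 ^ n) -> root2 n x <= e.
Proof.
move=> e0; rewrite -(root2K n) ler_pXn2r// ?nnegrE ?root2_ge0 ?ltW//.
by rewrite expn_gt0.
Qed.

Lemma root2_powR n (e x : R) : `|e| = 1 -> 0 < e * x -> root2 n x = (e * x) `^ (2%:R ^- n).
Proof. by move=> e1 ex; rewrite /root2 -[`|x|]mul1r -e1 -normrM gtr0_norm. Qed.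

Lemma root2_continuous n : continuous (@root2 R n).
Proof.
move=> x; have [->|x0] := eqVneq x 0.
  apply/cvgrPdist_lt => e e0; rewrite root2_0.
  near=> y; rewrite sub0r normrN ger0_norm ?root2_ge0//; apply: root2_lt => //.
  near: y; apply: cvgr0_norm_lt; last by rewrite exprn_gt0.
  exact: cvg_id.
pose e : R := Num.sg x.
have e1 : `|e| = 1 by rewrite normr_sg x0.
have ex : 0 < e * x by rewrite -normrEsg normr_gt0.
have oU : open [set y : R | 0 < e * y].
  apply: (@open_comp _ _ ( *%R e) [set x : R | 0 < x]); last exact: open_gt.
  by move=> y _; exact: mulrl_continuous.
have C : C_order 0 [set y : R | 0 < e * y] (root2 n).
  apply: C_order_eq (C_order_powR 0 e (2%:R ^- n)) => // y ey.
  by rewrite (root2_powR _ e1).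
exact: (C_order_continuous (ex : [set y : R | 0 < e * y] x) C).
Unshelve. all: by end_near. Qed.

Lemma root2_right n : root2 n t @[t --> (0 : R)^'+] --> (0 : R)^'+.
Proof.
move=> A [d /= d0 Hd].
have : \forall t \near (0 : R)^'+, t < d ^+ (2 ^ n) /\ 0 < t.
  near=> t; split; last by near: t; exact: nbhs_right_gt.
  by near: t; apply: nbhs_right_lt; rewrite exprn_gt0.
apply: filterS => t [td t0]; apply: Hd; last by apply: root2_gt0; rewrite gt_eqF.
rewrite /= sub0r normrN ger0_norm ?root2_ge0//; apply: root2_lt => //.
by rewrite gtr0_norm.
Unshelve. all: by end_near. Qed.

End Root2.

(** * One-sided domains and the asymptotics they carry *)

Section Sided.
Variable R : realType.
Implicit Types (K : domain_kind) (e l : R).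

(** [e] is the sign of lam on the one-sided domain K. Writing lam = e * t with t >= 0 treats both
    sides by one argument as t decreases to 0. *)
Definition is_side K e : Prop :=
  (K = left_sided /\ e = -1) \/ (K = right_sided /\ e = 1).

Lemma is_side_sq K e : is_side K e -> e * e = 1.
Proof. by move=> [] [_ ->]; rewrite ?mulrNN mulr1. Qed.

Lemma is_side_norm K e : is_side K e -> `|e| = 1.
Proof. by move=> [] [_ ->]; rewrite ?normrN normr1. Qed.

Lemma is_side_domain K e l lam : is_side K e ->
  domain K l lam <-> 0 <= e * lam < l.
Proof.
move=> [] [-> ->] /=; rewrite in_itv/=.
  by rewrite mulN1r oppr_ge0 ltrNl andbC.
by rewrite mul1r.
Qed.

Lemma is_side_near K e l (P : R -> Prop) : is_side K e -> 0 < l ->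
  (\forall lam \near within (domain K l `\ 0) (nbhs (0 : R)), P lam) <->
  (\forall t \near 0^'+, P (e * t)).
Proof.
move=> Ke l0; have ee := is_side_sq Ke; have e1 := is_side_norm Ke.
split=> [[d /= d0 Hd]|[d /= d0 Hd]].
  exists (Num.min d l) => /=; first by rewrite lt_min d0.
  move=> t /=; rewrite sub0r normrN lt_min => /andP[td tl] t0.
  apply: Hd; first by rewrite /= sub0r normrN normrM e1 mul1r.
  split; first by apply/(is_side_domain _ _ Ke); rewrite mulrA ee mul1r ltW//= -(gtr0_norm t0).
  by move=> /= /eqP; rewrite mulf_eq0 (gt_eqF t0) orbF -normr_eq0 e1 oner_eq0.
exists d => //= lam /= ld [/(is_side_domain _ _ Ke)/andP[el _] lam0].
rewrite -[lam]mul1r -ee -mulrA; apply: Hd.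
  by move: ld; rewrite /= !sub0r !normrN normrM e1 mul1r.
rewrite lt_neqAle el andbT eq_sym mulf_eq0 -normr_eq0 e1 oner_eq0/=.
by apply/eqP.
Qed.

Lemma is_side_cvg K e l (g : R -> R) (s : R) : is_side K e -> 0 < l ->
  (g lam @[lam --> within (domain K l `\ 0) (nbhs (0 : R))] --> s) <->
  (g (e * t) @[t --> 0^'+] --> s).
Proof.
move=> Ke l0; split=> H A /H.
  exact: (is_side_near (fun x => A (g x)) Ke l0).1.
exact: (is_side_near (fun x => A (g x)) Ke l0).2.
Qed.

(** This leading-order behaviour is all that the comparisons with other branches and other orders
    need from an expansion. The factor e appears because the slope divides by lam and not by
    |lam|. *)
Lemma sqrt_expansion_lim K e l (u : R -> R) n (s : R) : is_side K e -> 0 < l ->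
  sqrt_expansion (domain K l) l u n s ->
  u (e * t) / root2 n t @[t --> 0^'+] --> e * s.
Proof.
move=> Ke l0 [v [_ uv sv _]].
have ee := is_side_sq Ke; have e1 := is_side_norm Ke.
have {}sv := (is_side_cvg _ _ Ke l0).1 sv.
have vt : v t / t @[t --> (0 : R)^'+] --> e * s.
  have : e * (v `|e * t| / (e * t)) @[t --> (0 : R)^'+] --> e * s by exact: cvgMl_tmp.
  apply: cvg_trans; apply: near_eq_cvg; near=> t.
  have t0 : 0 < t by near: t; exact: nbhs_right_gt.
  have e0 : e != 0 by rewrite -normr_eq0 e1 oner_eq0.
  rewrite normrM e1 mul1r gtr0_norm//; field.
  by rewrite e0 gt_eqF.
have := cvg_comp _ _ (@root2_right R n) vt.
apply: cvg_trans; apply: near_eq_cvg; near=> t.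
have t0 : 0 < t by near: t; exact: nbhs_right_gt.
rewrite uv; first by rewrite -[root2 n (e * t)]root2_abs normrM e1 mul1r root2_abs.
apply/(is_side_domain _ _ Ke); rewrite mulrA ee mul1r (ltW t0)/=.
by near: t; exact: nbhs_right_lt.
Unshelve. all: by end_near. Qed.

(* [root2 n' t = o(root2 n t)] for [n' < n]: two orders cannot coexist. *)
Lemma order_unique (u : R -> R) n n' (x y : R) : (n' < n)%N ->
  u t / root2 n t @[t --> (0 : R)^'+] --> x ->
  u t / root2 n' t @[t --> (0 : R)^'+] --> y -> x = 0.
Proof.
move=> n'n ux uy; apply: (cvg_unique (@norm_hausdorff R R) ux).
have c0 : root2 n t ^+ (2 ^ (n - n') - 1) @[t --> (0 : R)^'+] --> (0 : R).
  have := @exprn_continuous R (2 ^ (n - n') - 1) 0.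
  rewrite /continuous_at expr0_pow2_sub1 gtn_eqF ?subn_gt0// => H.
  apply: (cvg_comp _ _ _ H); apply: (cvg_trans (@root2_right R n)).
  exact: cvg_within.
have H : u t / root2 n' t * root2 n t ^+ (2 ^ (n - n') - 1) @[t --> (0 : R)^'+] --> (0 : R).
  by rewrite -[X in _ --> X](mulr0 y); exact: cvgM uy c0.
apply: cvg_trans H; apply: near_eq_cvg; near=> t.
have t0 : t != 0 by rewrite gt_eqF//; near: t; exact: nbhs_right_gt.
have r0 : root2 n t != 0 by rewrite gt_eqF// root2_gt0.
have -> : root2 n' t = root2 n t * root2 n t ^+ (2 ^ (n - n') - 1).
  have := root2_pow (n - n') n' t; rewrite subnK ?(ltnW n'n)// => <-.
  by rewrite -exprS subn1 prednK// expn_gt0.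
move: (root2 n t) r0 (_ ^+ _) (expf_neq0 (2 ^ (n - n') - 1) r0) (u t) => a a0 b b0 v.
by rewrite /=; field; rewrite a0 b0.
Unshelve. all: by end_near. Qed.

End Sided.

(** * Existence and uniqueness of the branch *)

Section Realization.
Variables (R : realType) (k : nat) (N : network k) (f : 'rV[R]_(1 + k + 1) -> R).
Variables (delta : int) (p : cell N -> int) (s : cell N -> R).
Hypotheses (fV : calV0 f) (hO : Omega f delta p s) (pge : forall c, -1 <= p c).
Variables (q : cell N -> R -> R) (r : R).
Hypotheses (r01 : 0 < r <= 1) (Hq : forall c, profile_at f delta p s q r c).

Let sd : R := side R delta.
Let r0 : 0 < r. Proof. by case/andP: r01. Qed.
Let r1 : r <= 1. Proof. by case/andP: r01. Qed.

(** The parameter mu of c. For delta = 0 it keeps the sign of lam, which makes the branch smooth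
    through 0. At order -1 its value is irrelevant, the profile being zero. *)
Definition param (c : cell N) (lam : R) : R :=
  if delta == 0 then lam else root2 `|p c|%N lam.

Definition bval (lam : R) (c : cell N) : R := param c lam * q c (param c lam).

Definition onside (lam : R) : Prop := delta = 0 \/ 0 <= sd * lam.

Lemma sd_norm : `|sd| = 1.
Proof. by rewrite /sd /side; case: ifP => _; rewrite ?normrN normr1. Qed.

Lemma order_delta0 c (n : nat) : p c = n%:Z -> delta = 0 -> n = 0%N.
Proof. by move=> pc d0; have [_ /(_ d0)/(_ c)] := hO; rewrite pc; case: n pc. Qed.

Lemma order_cases c : p c = -1 \/ exists n : nat, p c = n%:Z.
Proof.
by have := pge c; case: (p c) => [n|[|n]]//; [right; exists n|left].
Qed.

Lemma side_delta0 : delta = 0 -> sd = 1.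
Proof. by rewrite /sd /side => ->. Qed.

Lemma bval_m1 c lam : p c = -1 -> bval lam c = 0.
Proof. by move=> pc; have [_ _ /(_ pc) q0 _] := Hq c; rewrite /bval q0 mulr0. Qed.

Lemma param_pow c n lam : p c = n%:Z -> onside lam -> sd * param c lam ^+ (2 ^ n) = lam.
Proof.
move=> pc; rewrite /param; case: eqVneq => [d0 _|d0 [/eqP|sl]].
- by rewrite (order_delta0 pc d0) side_delta0// mul1r.
- by rewrite (negbTE d0).
rewrite pc root2K -[`|lam|]mul1r -sd_norm -normrM ger0_norm//.
by rewrite mulrA side2 mul1r.
Qed.

(** The parameter of a source of order n' is that of c raised to 2^(n - n'). If the source has order
    -1, in particular whenever delta = 0, both sides vanish. *)
Lemma bval_src c n i lam : p c = n%:Z -> bval lam (src i c) =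
  param c lam ^+ (2 ^ gap p n c i) * q (src i c) (param c lam ^+ (2 ^ gap p n c i)).
Proof.
move=> pc; have [p1|[n' p1]] := order_cases (src i c).
  rewrite bval_m1//; have [_ _ /(_ p1) q0 _] := Hq (src i c).
  by rewrite q0 mulr0.
have := src_lt (c := c) hO i; rewrite pc p1 => /(_ isT) n'n.
have d0 : delta != 0 by apply/eqP => /(order_delta0 pc) n0; move: n'n; rewrite n0.
rewrite /bval /param (negbTE d0) pc p1 /gap p1.
have -> : `|n%:Z - n'%:Z|%N = (n - n')%N by lia.
have -> : `|n%:Z|%N = (n - n' + n')%N by lia.
by rewrite root2_pow.
Qed.

Lemma cell_argE c n lam z : p c = n%:Z -> onside lam ->
  cell_arg delta p q c n (param c lam) z =
  vars (param c lam * z) (fun i => bval lam (src i c)) lam.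
Proof.
move=> pc ol; rewrite /cell_arg; congr vars; last exact: param_pow.
by apply/funext => i; rewrite (bval_src _ _ pc).
Qed.

(** For |lam| < rad every parameter is smaller than r; as r <= 1, the largest order gives the
    strongest constraint. *)
Definition rad : R := r ^+ (2 ^ \max_c `|p c|%N).

Lemma rad_gt0 : 0 < rad. Proof. exact: exprn_gt0. Qed.

Lemma rad_le c : rad <= r ^+ (2 ^ `|p c|).
Proof.
apply: ler_wiXn2l => //; first exact: ltW.
by rewrite leq_exp2l//; exact: (leq_bigmax c).
Qed.

Lemma rad_le_r : rad <= r.
Proof. by rewrite -[leRHS]expr1; apply: ler_wiXn2l; rewrite ?expn_gt0// ltW. Qed.

Lemma param_lt c lam : `|lam| < rad -> `|param c lam| < r.
Proof.
rewrite /param => lr; case: eqVneq => _; first exact: lt_le_trans rad_le_r.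
rewrite ger0_norm ?root2_ge0//; apply: root2_lt => //.
exact: lt_le_trans (rad_le c).
Qed.

Lemma src_m1 c i : p c = -1 -> p (src i c) = -1.
Proof. by have [_ _ /(_ c)[+ _ _ _ _]] := hO => /[apply]. Qed.

Lemma bval_eq c lam : `|lam| < rad -> onside lam -> network_field f (bval lam) lam c = 0.
Proof.
move=> lr ol; have [pc|[n pc]] := order_cases c; rewrite /network_field.
  rewrite bval_m1// (_ : (fun i => _) = fun=> 0); first by have [[_ f0] _] := fV.
  by apply/funext => i; rewrite bval_m1//; exact: src_m1.
have [_ _ _ /(_ n pc)[H _]] := Hq c.
by rewrite /bval -(cell_argE _ pc)// H// param_lt.
Qed.

Definition branch_kind : domain_kind :=
  if delta == 0 then two_sided else if delta == 1 then right_sided else left_sided.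

Lemma branch_kind_side : delta != 0 -> is_side branch_kind sd.
Proof.
rewrite /branch_kind /sd /side; have [+ _ _] := hO; rewrite !inE.
by move=> /or3P[]/eqP -> //= _; [left|right].
Qed.

Lemma branch_kind_domain lam : domain branch_kind rad lam -> `|lam| < rad /\ onside lam.
Proof.
have [d0|d0] := eqVneq delta 0.
  by rewrite /branch_kind d0 eqxx /= in_itv/= -ltr_norml; split => //; left.
move/(is_side_domain _ _ (branch_kind_side d0)) => /andP[h1 h2]; split; last by right.
by rewrite -[`|lam|]mul1r -sd_norm -normrM ger0_norm.
Qed.

Lemma bval_continuous c lam : `|lam| < rad -> {for lam, continuous (bval^~ c)}.
Proof.
move=> lr; have [Cq _ _ _] := Hq c.
have cp : {for lam, continuous (param c)}.
  rewrite /param; case: eqP => _; [exact: cvg_id|exact: root2_continuous].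
apply: cvgM; first exact: cp.
apply: (@continuous_comp _ _ _ (param c) (q c)) cp _.
exact: (C_order_continuous (U := [set x : R | `|x| < r]) (param_lt c lr) (Cq 0%N)).
Qed.

Lemma C_order_bval c n : delta != 0 ->
  C_order n [set x : R | 0 < sd * x /\ `|x| < rad] (bval^~ c).
Proof.
move=> d0; have [Cq _ _ _] := Hq c.
have o1 : open [set x : R | 0 < sd * x].
  apply: (@open_comp _ _ ( *%R sd) [set x : R | 0 < x]); last exact: open_gt.
  by move=> x _; exact: mulrl_continuous.
have oU : open [set x : R | 0 < sd * x /\ `|x| < rad].
  by apply: (openI o1); exact: open_disk.
have Cp : C_order n [set x : R | 0 < sd * x /\ `|x| < rad] (param c).
  apply: (@C_order_eq _ _ _ _ (fun x => (sd * x) `^ (2%:R ^- `|p c|%N))) => //.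
    by move=> x [x0 _]; rewrite /param (negbTE d0) (root2_powR _ sd_norm).
  by apply: C_order_sub (C_order_powR n sd _) => x [].
apply: C_orderM => //.
apply: (C_order_comp1 oU (open_disk (r := r))) Cp (Cq n).
by move=> x [_ xr]; exact: param_lt.
Qed.

Lemma exists_branch : exists b : branch N f,
  [/\ kind b = branch_kind, Defs.radius b = rad & bfun b = bval].
Proof.
have at0 c : bval 0 c = 0.
  by rewrite /bval /param; case: eqP; rewrite ?root2_0 mul0r.
have eq0 lam : domain branch_kind rad lam -> forall c, network_field f (bval lam) lam c = 0.
  by move=> /branch_kind_domain[lr ol] c; exact: bval_eq.
unshelve eexists (@Branch R k N f branch_kind rad bval rad_gt0 at0 eq0 _) => // c.
  have [d0|d0] := eqVneq delta 0.
    have E : branch_kind = two_sided by rewrite /branch_kind d0 eqxx.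
    rewrite E => lam; rewrite -E => /branch_kind_domain[lr _].
    have [Cq _ _ _] := Hq c.
    exists [set x : R | `|x| < r], (bval^~ c); split => //.
    - exact: open_disk.
    - exact: lt_le_trans rad_le_r.
    - move=> n; rewrite /bval /param d0 eqxx.
      apply: C_orderM; [exact: open_disk|exact: C_order_id|exact: Cq].
  have H : {within domain branch_kind rad, continuous (bval^~ c)} /\
           smooth_on (domain branch_kind rad `\ 0) (bval^~ c).
    split.
      apply/continuous_in_subspaceT => x /set_mem /branch_kind_domain[xr _].
      exact: bval_continuous.
    move=> x [/branch_kind_domain[xr [d0'|sx]] /eqP x0]; first by rewrite d0' eqxx in d0.
    exists [set x : R | 0 < sd * x /\ `|x| < rad], (bval^~ c); split => //.
    - apply: (@openI _ [set x : R | 0 < sd * x]); last exact: open_disk.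
      apply: (@open_comp _ _ ( *%R sd) [set x : R | 0 < x]); last exact: open_gt.
      by move=> y _; exact: mulrl_continuous.
    - split => //; rewrite lt_neqAle sx andbT eq_sym mulf_neq0//.
      by rewrite -normr_eq0 sd_norm oner_eq0.
    - by move=> n; exact: C_order_bval.
  by case: branch_kind (branch_kind_side d0) H => // -[] [].
Qed.

(** The sign of the parameter at lam = e * t: that of lam for delta = 0, positive otherwise. *)
Definition kappa (e : R) : R := if delta == 0 then e else 1.

Lemma kappa_q0 e c : delta = 0 \/ e = sd -> kappa e * q c 0 = e * s c.
Proof.
have [_ <- _ _] := Hq c; rewrite /kappa; case: eqVneq => [d0 _|d0 [/eqP|->]].
- by rewrite -/sd side_delta0// mul1r.
- by rewrite (negbTE d0).
- by rewrite mulrA side2.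
Qed.

Lemma kappa_sq K e : is_side K e -> kappa e * kappa e = 1.
Proof. by move=> /is_side_sq ee; rewrite /kappa; case: ifP => _; rewrite ?mulr1. Qed.

Lemma param_side K e c n t : is_side K e -> p c = n%:Z -> 0 <= t ->
  param c (e * t) = kappa e * root2 n t.
Proof.
move=> Ke pc t0; rewrite /param /kappa; case: eqVneq => [d0|d0].
  by rewrite (order_delta0 pc d0) root2_0n ger0_norm.
by rewrite pc mul1r -root2_abs normrM (is_side_norm Ke) mul1r root2_abs.
Qed.

Lemma kappa_norm K e : is_side K e -> `|kappa e| = 1.
Proof. by rewrite /kappa; case: eqP => _ /is_side_norm => [->//|_]; rewrite normr1. Qed.

Lemma kappa_q_cvg (F : set_system R) {FF : Filter F} K e c (x : R -> R) :
  is_side K e -> x t @[t --> F] --> (0 : R) ->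
  kappa e * q c (kappa e * x t) @[t --> F] --> kappa e * q c 0.
Proof.
move=> Ke x0; apply: cvgMl_tmp; have [Cq _ _ _] := Hq c.
have kx : kappa e * x t @[t --> F] --> (0 : R).
  by rewrite -[X in _ --> X](mulr0 (kappa e)); exact: cvgMl_tmp.
apply: (cvg_comp _ _ kx).
have D0 : [set x : R | `|x| < r] 0 by rewrite /= normr0.
exact: (C_order_continuous D0 (Cq 0%N)).
Qed.

Lemma bval_lim K e c n : is_side K e -> delta = 0 \/ e = sd -> p c = n%:Z ->
  bval (e * t) c / root2 n t @[t --> (0 : R)^'+] --> e * s c.
Proof.
move=> Ke de pc; rewrite -(kappa_q0 c de).
have r20 : root2 n t @[t --> (0 : R)^'+] --> (0 : R).
  by apply: (cvg_trans (@root2_right R n)); exact: cvg_within.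
apply: cvg_trans (kappa_q_cvg (c := c) Ke r20); apply: near_eq_cvg; near=> t.
have t0 : 0 < t by near: t; exact: nbhs_right_gt.
have rt0 : root2 n t != 0 by rewrite gt_eqF// root2_gt0// gt_eqF.
rewrite /bval (param_side Ke pc (ltW t0)).
by rewrite mulrAC -[kappa e * _ / _]mulrA divff// mulr1.
Unshelve. all: by end_near. Qed.

Lemma slope_neq0 c n : p c = n%:Z -> s c != 0.
Proof.
by move=> pc; have [_ _ /(_ c)[_ _ [_ h] _ _]] := hO; apply/eqP => /h; rewrite pc.
Qed.

(** The order is minimal because an expansion of smaller order would, by [order_unique], force the
    nonzero limit e * s c to vanish. *)
Lemma bval_order_slope K e c : is_side K e -> delta = 0 \/ e = sd ->
  order_slope (domain K rad) rad (bval^~ c) (p c) (s c).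
Proof.
move=> Ke de; have [pc|[n pc]] := order_cases c.
  left; split => //; first by apply: nearW => lam; rewrite bval_m1.
  by have [_ _ /(_ c)[_ _ [h _] _ _]] := hO; exact: h.
have ee := is_side_sq Ke; have e1 := is_side_norm Ke.
right; exists n => //; split; last first.
  move=> n' s' n'n H; have es0 : e * s c != 0.
    by rewrite mulf_neq0 ?(slope_neq0 pc)// -normr_eq0 e1 oner_eq0.
  move/eqP: es0; apply; apply: (order_unique n'n (bval_lim Ke de pc)).
  exact: (sqrt_expansion_lim Ke rad_gt0 H).
(* x stands for |lam|^(2^-n), and [kappa e] restores the sign of the parameter. *)
exists (fun x => kappa e * x * q c (kappa e * x)); split.
- have [Cq _ _ _] := Hq c; move=> x /=; rewrite in_itv/= => /andP[x0 xr].
  exists [set x : R | `|x| < r], (fun x => kappa e * x * q c (kappa e * x)); split => //.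
  + exact: open_disk.
  + rewrite /= ger0_norm//; apply: lt_le_trans xr _; apply: root2_le => //.
    by rewrite gtr0_norm ?rad_gt0//; have := rad_le c; rewrite pc.
  + move=> j; have oD := open_disk (r := r).
    have Ck : C_order j [set x : R | `|x| < r] (fun x => kappa e * x).
      by apply: C_orderM => //; [exact: C_order_cst|exact: C_order_id].
    apply: C_orderM => //; apply: (C_order_comp1 oD oD) Ck (Cq j).
    by move=> y /=; rewrite normrM (kappa_norm Ke) mul1r.
- move=> lam /(is_side_domain _ _ Ke)/andP[el _].
  rewrite /bval -{1 2}[lam]mul1r -ee -mulrA (param_side Ke pc el).
  by rewrite -[root2 n (e * lam)]root2_abs normrM e1 mul1r root2_abs.
- apply/(is_side_cvg _ _ Ke rad_gt0).
  have c0 : (t : R) @[t --> (0 : R)^'+] --> (0 : R) by exact: cvg_within.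
  have c1 : e * (kappa e * q c (kappa e * t)) @[t --> (0 : R)^'+] -->
      e * (kappa e * q c 0) by apply: cvgMl_tmp; exact: kappa_q_cvg Ke c0.
  rewrite (kappa_q0 c de) mulrA ee mul1r in c1.
  apply: cvg_trans c1; apply: near_eq_cvg; near=> t.
  have t0 : 0 < t by near: t; exact: nbhs_right_gt.
  rewrite normrM e1 mul1r gtr0_norm// invfM.
  have -> : e^-1 = e by rewrite -[LHS]mul1r -ee mulrK// unitfE -normr_eq0 e1 oner_eq0.
  by field; rewrite gt_eqF.
- exact: slope_neq0 pc.
Unshelve. all: by end_near. Qed.

Lemma bdomain_side (b : branch N f) K e t : is_side K e ->
  kind b = K \/ kind b = two_sided -> 0 <= t < Defs.radius b -> bdomain b (e * t).
Proof.
move=> Ke kb tr; have H : domain K (Defs.radius b) (e * t).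
  by apply/(is_side_domain _ _ Ke); rewrite mulrA (is_side_sq Ke) mul1r.
rewrite /bdomain; case: kb => -> //.
have /andP[t0 tr'] := tr; rewrite /= in_itv/= -ltr_norml normrM (is_side_norm Ke).
by rewrite mul1r ger0_norm.
Qed.

Lemma germ_agree (b1 b2 : branch N f) K e : is_side K e ->
  kind b1 = K \/ kind b1 = two_sided -> kind b2 = K \/ kind b2 = two_sided ->
  germ_related b1 b2 -> forall c, \forall t \near (0 : R)^'+, b1 (e * t) c = b2 (e * t) c.
Proof.
move=> Ke k1 k2 [U [oU U0 _ H]] c.
have [d /= d0 Hd] := open_nbhs_nbhs (conj oU U0).
near=> t.
have t0 : 0 < t by near: t; exact: nbhs_right_gt.
apply: H; split; first split.
- by apply: Hd; rewrite /= sub0r normrN normrM (is_side_norm Ke) mul1r gtr0_norm.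
- apply: (bdomain_side Ke k1); rewrite (ltW t0)/=.
  by near: t; apply: nbhs_right_lt; exact: radius_gt0.
- apply: (bdomain_side Ke k2); rewrite (ltW t0)/=.
  by near: t; apply: nbhs_right_lt; exact: radius_gt0.
Unshelve. all: by end_near. Qed.

(** Domains on opposite sides meet in 0 alone, which the relation excludes. *)
Lemma germ_related_kind (b1 b2 : branch N f) K (e : R) : is_side K e -> kind b1 = K ->
  germ_related b1 b2 -> kind b2 = K \/ kind b2 = two_sided.
Proof.
move=> Ke k1 [U [oU U0 ne _]].
have dom0 (b : branch N f) : bdomain b 0.
  have := radius_gt0 b; rewrite /bdomain; case: (kind b) => /=; rewrite in_itv/=;
  by move=> h; rewrite ?oppr_lt0 ?lexx ?h.
case E : (kind b2); [|by right|]; case: (Ke) => -[k' _]; rewrite k'; try by left.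
  case: ne; apply/seteqP; split => [lam [[_]]|lam /= ->]; last by do 2![split => //].
  rewrite /bdomain k1 E k' /= !in_itv/= => /andP[l0 _] /andP[_ l1].
  by apply/eqP; rewrite eq_le l0 l1.
case: ne; apply/seteqP; split => [lam [[_]]|lam /= ->]; last by do 2![split => //].
rewrite /bdomain k1 E k' /= !in_itv/= => /andP[_ l0] /andP[l1 _].
by apply/eqP; rewrite eq_le l0 l1.
Qed.

(** Induction on the order: once the sources agree with [bval], b_c solves the very equation that
    determines the profile of c. *)
Lemma Theta_bval (b : branch N f) K e : Theta b delta p s -> is_side K e ->
  kind b = K \/ kind b = two_sided -> delta = 0 \/ e = sd ->
  forall c, \forall t \near (0 : R)^'+, b (e * t) c = bval (e * t) c.
Proof.
move=> [_ Hb] Ke kb de.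
have ee := is_side_sq Ke; have e1 := is_side_norm Ke.
have HK c : order_slope (domain K (Defs.radius b)) (Defs.radius b) (b^~ c) (p c) (s c).
  have := Hb c; rewrite /cell_order_slope; case: kb => ->.
    by case: (K) (Ke) => // -[] [].
  by case: (Ke) => -[-> _] [].
suff H n c : p c < n%:Z ->
    \forall t \near (0 : R)^'+, b (e * t) c = bval (e * t) c.
  by move=> c; apply: (H `|p c|%N.+1); lia.
elim: n c => [|n IH] c pcn.
  have pc : p c = -1 by have := pge c; lia.
  have [[H _ _]|[m pm _]] := HK c; last by rewrite pc in pm.
  have {}H : \forall lam \near within (domain K (Defs.radius b) `\ 0) (nbhs (0 : R)), b lam c = 0.
    by case: H => d d0 Hd; exists d => // lam ld [Dl _]; exact: Hd.
  have := (is_side_near _ Ke (radius_gt0 b)).1 H.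
  by apply: filterS => t ->; rewrite bval_m1.
have [pc|[m pc]] := order_cases c; first by apply: IH; rewrite pc.
have [[_ pm _]|[m' pm [H _]]] := HK c; first by rewrite pc in pm.
have mm' : m' = m by move: pm; rewrite pc => -[].
rewrite {}mm' in H.
have lim := sqrt_expansion_lim Ke (radius_gt0 b) H.
(* b_c divided by the parameter of c, as [kappa e] is its own inverse. It tends to [q c 0] and so
   enters the range of local uniqueness. *)
pose z (t : R) := kappa e * (b (e * t) c / root2 m t).
have zlim : z t @[t --> (0 : R)^'+] --> q c 0.
  rewrite -[q c 0]mul1r -(kappa_sq Ke) -mulrA (kappa_q0 c de).
  by apply: cvgMl_tmp; exact: lim.
have IHs : \forall t \near (0 : R)^'+, forall i, b (e * t) (src i c) = bval (e * t) (src i c).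
  apply: filter_forall => i; apply: IH.
  by have := src_lt (c := c) hO i; rewrite pc => /(_ isT); move: pcn; rewrite pc; lia.
have zr := (cvgrPdist_lt _ _).1 zlim _ r0.
near=> t.
have t0 : 0 < t by near: t; exact: nbhs_right_gt.
have tr : t < rad by near: t; apply: nbhs_right_lt; exact: rad_gt0.
have tb : t < Defs.radius b by near: t; apply: nbhs_right_lt; exact: radius_gt0.
have etn : `|e * t| = t by rewrite normrM e1 mul1r gtr0_norm.
have ol : onside (e * t).
  case: de => [|->]; first by left.
  by right; rewrite mulrA side2 mul1r ltW.
have pt : param c (e * t) = kappa e * root2 m t by apply: (param_side Ke pc); exact: ltW.
have rt0 : root2 m t != 0 by rewrite gt_eqF// root2_gt0// gt_eqF.
have k0 : kappa e != 0 by rewrite -normr_eq0 (kappa_norm Ke) oner_eq0.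
have p0 : param c (e * t) != 0 by rewrite pt mulf_neq0.
have pz : param c (e * t) * z t = b (e * t) c.
  rewrite pt /z mulrACA (kappa_sq Ke) mul1r mulrC divfK//.
have [_ _ _ /(_ m pc)[_ uq]] := Hq c.
rewrite -pz /bval; congr (_ * _); apply: uq => //.
- by apply: param_lt; rewrite etn.
- by rewrite distrC; near: t; exact: zr.
rewrite (cell_argE _ pc)// pz.
have -> : (fun i => bval (e * t) (src i c)) = (fun i => b (e * t) (src i c)).
  apply/funext => i; apply/esym; move: i; near: t; exact: IHs.
apply: (branch_eq (b := b)); apply: (bdomain_side Ke kb).
by rewrite ltW.
Unshelve. all: by end_near. Qed.

Lemma Theta_kind (b : branch N f) : delta != 0 -> Theta b delta p s -> kind b = branch_kind.
Proof.
rewrite /branch_kind => d0 [[[d _]|[-> [_ ->]]|[-> [_ ->]]] _] //.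
by rewrite d in d0.
Qed.

(** A single step of the relation suffices. For delta = 0 the representative b' may still be
    one-sided, since [has_delta] only asks for an extension within its class; agreement is therefore
    proved on whichever sides b' is defined. *)
Lemma Theta_unique (b b' : branch N f) : kind b = branch_kind ->
  Defs.radius b = rad -> bfun b = bval -> Theta b' delta p s -> germ_equiv b b'.
Proof.
move=> kb rb fb Tb'; apply: t_step.
have at0 c : bval 0 c = 0 by rewrite -fb branch_at0.
have side_ok K e : is_side K e -> kind b' = K \/ kind b' = two_sided ->
    delta = 0 \/ e = sd.
  have [->|d0] := eqVneq delta 0; first by left.
  move=> Ke; rewrite (Theta_kind d0 Tb') => kk; right; move: kk.
  by case: (branch_kind_side d0) => -[-> ->]; case: Ke => -[-> ->] // -[].
have near_side K e : is_side K e -> kind b' = K \/ kind b' = two_sided ->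
    \forall d \near (0 : R)^'+, forall lam, `|lam| < d -> 0 <= e * lam ->
      forall c, b lam c = b' lam c.
  move=> Ke kb'.
  have : \forall t \near (0 : R)^'+, forall c, b' (e * t) c = bval (e * t) c.
    by apply: filter_forall; exact: (Theta_bval Tb' Ke kb' (side_ok _ _ Ke kb')).
  move=> [d /= d0 Hd]; near=> d' => lam lamd el c; rewrite fb.
  have [->|lam0] := eqVneq lam 0; first by rewrite at0 branch_at0.
  rewrite -[lam]mul1r -(is_side_sq Ke) -mulrA Hd//.
    rewrite /= sub0r normrN normrM (is_side_norm Ke) mul1r.
    by apply: lt_trans lamd _; near: d'; exact: nbhs_right_lt.
  by rewrite lt_neqAle el andbT eq_sym mulf_neq0// -normr_eq0 (is_side_norm Ke) oner_eq0.
have nearall : \forall d \near (0 : R)^'+, forall lam, `|lam| < d -> bdomain b' lam ->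
      forall c, b lam c = b' lam c.
  case E : (kind b').
  - have Ke : is_side left_sided (-1 : R) by left.
    apply: filterS (near_side _ _ Ke (or_introl E)) => d H lam ld.
    by rewrite /bdomain E => /(is_side_domain _ _ Ke)/andP[el _]; exact: H.
  - have Kl : is_side left_sided (-1 : R) by left.
    have Kr : is_side right_sided (1 : R) by right.
    apply: filterS2 (near_side _ _ Kl (or_intror E)) (near_side _ _ Kr (or_intror E)).
    move=> d Hl Hr lam ld _; have [l0|/ltW l0] := leP 0 lam.
      by apply: Hr; rewrite ?mul1r.
    by apply: Hl; rewrite ?mulN1r ?oppr_ge0.
  - have Ke : is_side right_sided (1 : R) by right.
    apply: filterS (near_side _ _ Ke (or_introl E)) => d H lam ld.
    by rewrite /bdomain E => /(is_side_domain _ _ Ke)/andP[el _]; exact: H.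
(* A side on which both branches are defined, needed to see that their domains share more than 0. *)
have [K [e [Ke kbK kbK']]] : exists (K : domain_kind) (e : R), [/\ is_side K e,
    kind b = K \/ kind b = two_sided & kind b' = K \/ kind b' = two_sided].
  have [d0|d0] := eqVneq delta 0; last first.
    exists branch_kind, sd; split; first exact: branch_kind_side.
      by left.
    by left; exact: Theta_kind.
  rewrite kb /branch_kind d0 eqxx; case: (kind b').
  - by exists left_sided, (-1); split; [left|right|left].
  - by exists left_sided, (-1); split; [left|right|right].
  - by exists right_sided, 1; split; [right|right|left].
have [d [d0 Hd]] : exists d : R, 0 < d /\
    forall lam, `|lam| < d -> bdomain b' lam -> forall c, b lam c = b' lam c.
  near (0 : R)^'+ => d; exists d; split; first by near: d; exact: nbhs_right_gt.
  by near: d; exact: nearall.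
exists [set x : R | `|x| < d]; split => //.
- exact: open_disk.
- by rewrite /= normr0.
- near (0 : R)^'+ => t.
  have t0 : 0 < t by near: t; exact: nbhs_right_gt.
  have tr : t < rad by near: t; apply: nbhs_right_lt; exact: rad_gt0.
  have tb : t < Defs.radius b' by near: t; apply: nbhs_right_lt; exact: radius_gt0.
  have td : t < d by near: t; apply: nbhs_right_lt.
  move=> /seteqP[+ _] => /(_ (e * t)) H.
  have /H/eqP : ([set x : R | `|x| < d] `&` bdomain b `&` bdomain b') (e * t).
    split; first split.
    - by rewrite /= normrM (is_side_norm Ke) mul1r gtr0_norm.
    - by apply: (bdomain_side Ke kbK); rewrite rb (ltW t0).
    - by apply: (bdomain_side Ke kbK'); rewrite (ltW t0).
  by rewrite mulf_eq0 (gt_eqF t0) orbF -normr_eq0 (is_side_norm Ke) oner_eq0.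
- by move=> lam [[ld _] lb'] c; exact: Hd.
Unshelve. all: by end_near. Qed.

Hypothesis hpos : delta != 0 -> exists c, 0 < p c.

(** Agreement with [bval] has to be carried along the chain together with the kind. It is what rules
    out a two-sided member: such a branch is differentiable at 0, whereas a cell of positive order
    has a nonzero limit after division by a proper root of |lam|. *)
Lemma bval_germ_kind (b1 b2 : branch N f) : delta != 0 -> germ_equiv b1 b2 ->
  kind b1 = branch_kind ->
  (forall c, \forall t \near (0 : R)^'+, b1 (sd * t) c = bval (sd * t) c) ->
  kind b2 = branch_kind /\
  (forall c, \forall t \near (0 : R)^'+, b2 (sd * t) c = bval (sd * t) c).
Proof.
move=> d0 eq12; have Ke := branch_kind_side d0.
elim: eq12 => {b1 b2} [b1 b2 g12 k1 E1|b1 b2 b3 _ IH1 _ IH2 k1 E1]; last first.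
  by have [k2 E2] := IH1 k1 E1; exact: IH2.
have k2 := germ_related_kind Ke k1 g12.
have E2 c : \forall t \near (0 : R)^'+, b2 (sd * t) c = bval (sd * t) c.
  have := germ_agree Ke (or_introl k1) k2 g12 c; have := E1 c.
  by apply: filterS2 => t -> ->.
split => //; case: k2 => // k2.
have [c cpos] := hpos d0; have [n pc] : exists n : nat, p c = n.+1%:Z.
  by case: (p c) cpos => [[|n]|n]// _; exists n.
have : smooth_on (domain two_sided (Defs.radius b2)) (b2^~ c).
  by have := branch_reg b2 c; rewrite k2.
have oD : open (domain two_sided (Defs.radius b2)) by exact: itv_open.
move=> /(smooth_on_C_order _ oD)/(_ 1%N) C1.
have D0 : domain two_sided (Defs.radius b2) 0.
  by rewrite /= in_itv/= oppr_lt0 radius_gt0.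
have dl := C_order_derivable (v := sd) D0 C1.
(* The derivative at 0 in direction [sd] is a limit at order 0, to be compared with the limit at
   order n + 1. *)
have l1 : b2 (sd * t) c / root2 0 t @[t --> (0 : R)^'+] --> 'D_sd (b2^~ c) 0.
  have c1 : h^-1 *: (((b2^~ c) \o shift 0) (h *: sd) - b2 0 c) @[h --> (0 : R)^'+] -->
      'D_sd (b2^~ c) 0.
    by move=> A /dl[d d0' Hd]; exists d => // h hd h0; apply: Hd; rewrite ?gt_eqF.
  apply: cvg_trans c1; apply: near_eq_cvg; near=> t.
  have t0 : 0 < t by near: t; exact: nbhs_right_gt.
  rewrite root2_0n gtr0_norm//= addr0 branch_at0 subr0.
  by rewrite [LHS]mulrC [t *: sd]mulrC.
have l2 : b2 (sd * t) c / root2 n.+1 t @[t --> (0 : R)^'+] --> sd * s c.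
  apply: cvg_trans (bval_lim Ke (or_intror erefl) pc).
  by apply: near_eq_cvg; have := E2 c; apply: filterS => t ->.
have := order_unique (ltn0Sn n) l2 l1; move/eqP.
rewrite mulf_eq0 (negbTE (slope_neq0 pc)) orbF.
by rewrite -normr_eq0 sd_norm oner_eq0.
Unshelve. all: by end_near. Qed.

Lemma bval_Theta (b : branch N f) : kind b = branch_kind ->
  Defs.radius b = rad -> bfun b = bval -> Theta b delta p s.
Proof.
move=> kb rb fb; split; last first.
  move=> c; rewrite /cell_order_slope kb rb fb.
  have [d0|d0] := eqVneq delta 0.
    rewrite /branch_kind d0 eqxx; split; apply: (bval_order_slope c _ (or_introl d0)).
      by left; split.
    by right; split.
  have H := bval_order_slope c (branch_kind_side d0) (or_intror erefl).
  by case: branch_kind (branch_kind_side d0) H => // -[] [].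
have [d0|d0] := eqVneq delta 0.
  apply: Or31; split => //; exists b; last by rewrite kb /branch_kind d0 eqxx.
  (* A transitive closure is not reflexive by itself: b is related to itself because its domain
     contains rad / 2 besides 0. *)
  apply: t_step; exists setT; split => //; first exact: openT.
  rewrite setTI setIid => /seteqP[+ _] => /(_ (rad / 2)).
  have -> : bdomain b = domain two_sided rad.
    by rewrite /bdomain kb rb /branch_kind d0 eqxx.
  have h := rad_gt0; rewrite /= in_itv/= => H.
  have /H/eqP : - rad < rad / 2 < rad by apply/andP; split; lra.
  by rewrite gt_eqF// divr_gt0.
have nex : ~ extends_around0 b.
  move=> [b2 eqb k2].
  have [|k2' _] := bval_germ_kind d0 eqb kb.
    by move=> c; rewrite fb; exact: nearW.
  by have := branch_kind_side d0; rewrite -k2' k2 => -[] [].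
have [+ _ _] := hO; rewrite !inE => /or3P[]/eqP dE.
- by apply: Or33; split => //; split => //; rewrite kb /branch_kind dE.
- by rewrite dE in d0.
- by apply: Or32; split => //; split => //; rewrite kb /branch_kind dE.
Qed.

End Realization.

(** * Genericity *)

Section Genericity.
Variables (R : realType) (k : nat).
Local Notation n := (1 + k + 1)%N.
Implicit Types f g : 'rV[R]_n -> R.

Lemma partial_addZ m (f g : 'rV[R]_m -> R) (t : R) i : C_order 1 setT f ->
  C_order 1 setT g ->
  partial i (fun x => f x + t * g x) = (fun x => partial i f x + t * partial i g x).
Proof.
move=> Cf Cg; apply/funext => x.
have df := derivableP (C_order_derivable (v := delta_mx 0 i) (I : setT x) Cf).
have dg := derivableP (C_order_derivable (v := delta_mx 0 i) (I : setT x) Cg).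
have [_ E] := is_deriveD df (is_deriveM (is_derive_cst t x (delta_mx 0 i)) dg).
by rewrite /partial [LHS]E /GRing.scale/= mulr0 addr0.
Qed.

Lemma jet2_addZ f g (t : R) : (forall j, C_order j setT f) ->
  (forall j, C_order j setT g) ->
  jet2 (fun x => f x + t * g x) = jet2 f + t *: jet2 g.
Proof.
move=> Cf Cg; rewrite /jet2; congr pair.
  by apply/rowP => i; rewrite !mxE /d1 partial_addZ.
apply/matrixP => i j; rewrite !mxE /d2 (partial_addZ _ _ (Cf 1%N) (Cg 1%N)).
by rewrite partial_addZ//; apply: C_order_derive; [exact: Cf|exact: Cg].
Qed.

(** x_0 (x_0 + lam) vanishes on the lam axis and has no first-order part, so adding t times it stays
    in [calV0], while f_00 grows by 2 t and f_0lam by t. *)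
Definition perturb (x : 'rV[R]_n) : R := x 0 (ix0 k) * (x 0 (ix0 k) + x 0 (ilam k)).

Lemma C_order_perturb j : C_order j setT perturb.
Proof.
have oT := @openT 'rV[R]_n.
apply: C_orderM => //; first exact: C_order_coord.
by apply: C_orderD => //; exact: C_order_coord.
Qed.

Lemma partial_perturb i : partial i perturb = (fun x =>
  x 0 (ix0 k) * ((i == ix0 k)%:R + (i == ilam k)%:R) +
  (x 0 (ix0 k) + x 0 (ilam k)) * (i == ix0 k)%:R).
Proof.
apply/funext => x.
have d0 := is_derive_coord x (delta_mx 0 i) (ix0 k).
have dl := is_derive_coord x (delta_mx 0 i) (ilam k).
have [_ E] := is_deriveM d0 (is_deriveD d0 dl).
by rewrite /partial [LHS]E /GRing.scale/= !mxE/= ![_ == i]eq_sym.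
Qed.

Lemma d1_perturb i : d1 perturb i = 0.
Proof. by rewrite /d1 partial_perturb !mxE addr0 !mul0r addr0. Qed.

Lemma d2_perturb j : d2 perturb (ix0 k) j =
  (j == ix0 k)%:R + (j == ilam k)%:R + (j == ix0 k)%:R.
Proof.
rewrite /d2 partial_perturb.
have d0 := is_derive_coord (0 : 'rV[R]_n) (delta_mx 0 (ix0 k)) (ix0 k).
have dl := is_derive_coord (0 : 'rV[R]_n) (delta_mx 0 (ix0 k)) (ilam k).
set a := _ + _ in d0 dl *; set b := (j == ix0 k)%:R in a *.
have [_ E] := is_deriveD
  (is_deriveM d0 (is_derive_cst (a : R) (0 : 'rV[R]_n) (delta_mx 0 (ix0 k))))
  (is_deriveM (is_deriveD d0 dl) (is_derive_cst (b : R) (0 : 'rV[R]_n) (delta_mx 0 (ix0 k)))).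
rewrite /partial [LHS]E /GRing.scale/= !mxE/=.
by rewrite !mulr0 !add0r addr0 !mulr1.
Qed.

Lemma near_neq (c : R) : \forall t \near (0 : R)^', t != c.
Proof.
have [->|c0] := eqVneq c 0; first exact: nbhs_dnbhs_neq.
near=> t; have tc : `|t| < `|c| by near: t; apply: dnbhs0_lt; rewrite normr_gt0.
by apply: contraTneq tc => ->; rewrite ltxx.
Unshelve. all: by end_near. Qed.

End Genericity.

Theorem proposition5p3 (R : realType) (k : nat) (N : network k)
    (hN : feed_forward N) :
  generically (@calV0 R k) (fun f =>
    forall (delta : int) (p : cell N -> int) (s : cell N -> R),
      Omega f delta p s ->
      (forall c, -1 <= p c) ->
      (delta != 0 -> exists c, 0 < p c) ->
      exists b : branch N f,
        Theta b delta p s /\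
        forall b' : branch N f, Theta b' delta p s -> germ_equiv b b').
Proof.
pose W : set ('rV[R]_(1 + k + 1) * 'M[R]_(1 + k + 1)) :=
  [set x : 'rV[R]_(1 + k + 1) * 'M[R]_(1 + k + 1) | x.2 (ix0 k) (ix0 k) != 0 /\ x.2 (ix0 k) (ilam k) != 0].
have oW : open W.
  have oE i j : open [set x : 'rV[R]_(1 + k + 1) * 'M[R]_(1 + k + 1) | x.2 i j != 0].
    apply: (@open_comp _ _ (fun x : 'rV[R]_(1 + k + 1) * 'M[R]_(1 + k + 1) => x.2 i j)
      [set y : R | y != 0]); last exact: open_neq.
    move=> x _; apply: (@continuous_comp _ _ _ snd (fun M : 'M[R]_(1 + k + 1) => M i j)).
      exact: cvg_snd.
    exact: coord_continuous.
  by apply: openI; exact: oE.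
exists (W `&` (@jet2 R (1 + k + 1) @` @calV0 R k)); split.
- by exists W.
- move=> _ [f fV <-] B Bf; have [fC f0] := fV.
  have Cf j := calV_C_order j fC.
  (* Density: this line of jets tends to the given one, and each of the two conditions of W fails
     for a single value of t only. *)
  have path : jet2 f + t *: jet2 (@perturb R k) @[t --> (0 : R)^'] --> jet2 f.
    have H : jet2 f + t *: jet2 (@perturb R k) @[t --> (0 : R)] -->
       jet2 f + (0 : R) *: jet2 (@perturb R k).
      by apply: cvgD; [exact: cvg_cst|exact: scalel_continuous].
    rewrite scale0r addr0 in H.
    by move=> A cA; apply: nbhs_dnbhs; exact: H.
  near (0 : R)^' => t.
  exists (jet2 f + t *: jet2 (@perturb R k)); split; last by near: t; exact: path Bf.
  split.
    have t1 : t != - d2 f (ix0 k) (ix0 k) / 2 by near: t; exact: near_neq.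
    have t2 : t != - d2 f (ix0 k) (ilam k) by near: t; exact: near_neq.
    rewrite /W /= !mxE !d2_perturb !eqxx ilam_neq0 [ix0 k == _]eq_sym ilam_neq0.
    split; [apply: contraNneq t1 => h|apply: contraNneq t2 => h]; apply/eqP.
      by move: h; move: (d2 f _ _) => a /= h; lra.
    by move: h; move: (d2 f _ _) => a /= h; lra.
  exists (fun x => f x + t * perturb x); last by rewrite jet2_addZ//; exact: C_order_perturb.
  split; first split.
  + apply/smooth_on_C_order; first exact: openT.
    move=> j; apply: C_orderD => //; first exact: openT.
    apply: C_orderM; [exact: openT|exact: C_order_cst|exact: C_order_perturb].
  + by move=> lam; rewrite fC.2 /perturb vars_ix0 mul0r mulr0 addr0.
  + rewrite /d1 (partial_addZ _ _ (Cf 1%N) (C_order_perturb R k 1%N)).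
    by rewrite -/(d1 f _) -/(d1 _ _) f0 d1_perturb mulr0 addr0.
- move=> f fV [[/= f00 f0l] _] delta p s hO pge hpos.
  rewrite !mxE in f00 f0l.
  have [q [r [r01 Hq]]] := exists_profiles fV f00 f0l hO pge.
  have [b [kb rb fb]] := exists_branch fV hO pge r01 Hq.
  exists b; split; first exact: (bval_Theta hO pge r01 Hq hpos kb rb fb).
  by move=> b'; exact: (Theta_unique hO pge r01 Hq kb rb fb).
Unshelve. all: by end_near. Qed.
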